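(* Let $n\ge1$, let $\mathcal{Q}\subseteq H^2(\mathbb{T}^n)$ be a quotient module, let $X\in\mathcal{B}_1(\mathcal{Q})$ be a module map, and let $\psi=X(P_{\mathcal{Q}}1)$. Let $\mathcal{M}_{\mathcal{Q}}=\mathcal{Q}^{conj}+\mathcal{M}_n+H^2_0(\mathbb{T}^n)$, regarded as a linear subspace of $L^1(\mathbb{T}^n)$ with the norm $\|\cdot\|_1$, and define $X_{\mathcal{Q}}:\mathcal{M}_{\mathcal{Q}}\to\mathbb{C}$ by $X_{\mathcal{Q}}f=\int_{\mathbb{T}^n}\psi f\,d\mu$. Then $X$ is liftable if and only if $X_{\mathcal{Q}}$ is a contractive functional on $(\mathcal{M}_{\mathcal{Q}},\|\cdot\|_1)$.
   Context: $\mathbb{D}$ is the open unit disc, $\mathbb{T}$ the unit circle, $\mu$ the normalized Lebesgue measure on $\mathbb{T}^n$. $H^2(\mathbb{T}^n)$ is the closed subspace of $L^2(\mathbb{T}^n)$ of functions whose Fourier coefficients vanish off $\mathbb{Z}_+^n$ (identified with analytic functions on $\mathbb{D}^n$); $\|\cdot\|_p$ is the $L^p(\mathbb{T}^n,\mu)$ norm. $\mathcal{S}(\mathbb{D}^n)$ is the closed unit ball of $H^\infty(\mathbb{D}^n)$ (sup norm). For $\varphi\in H^\infty(\mathbb{D}^n)$, $T_\varphi f=\varphi f$ on $H^2(\mathbb{T}^n)$. A closed subspace $\mathcal{Q}\subseteq H^2(\mathbb{T}^n)$ is a quotient module if $T_{z_i}^*\mathcal{Q}\subseteq\mathcal{Q}$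 for all $i$; $P_{\mathcal{Q}}$ is the orthogonal projection onto $\mathcal{Q}$, $S_\varphi=P_{\mathcal{Q}}T_\varphi|_{\mathcal{Q}}$. $\mathcal{B}_1(\mathcal{Q})$ denotes the contractions on $\mathcal{Q}$; $X\in\mathcal{B}(\mathcal{Q})$ is a module map if $XS_{z_i}=S_{z_i}X$ for all $i$; a contractive module map $X$ is liftable if $X=S_\varphi$ for some $\varphi\in\mathcal{S}(\mathbb{D}^n)$. $S^{conj}=\{\bar f:f\in S\}$; $H^2_0(\mathbb{T}^n)=\{f\in H^2(\mathbb{T}^n):f(0)=0\}$; $\mathcal{M}_n=L^2(\mathbb{T}^n)\ominus(H^2(\mathbb{T}^n)^{conj}+H^2(\mathbb{T}^n))$ (closed span of monomials $z^k$, $k\in\mathbb{Z}^n$, with at least one positive and at least one negative exponent). Contractive means $|X_{\mathcal{Q}}f|\le\|f\|_1$ for all $f$. *)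

(* Defs.v *)
(* MathComp + MathComp-Analysis (R : realType), complex numbers R[i]
   from mathcomp-real-closed. *)
From HB Require Import structures.
From mathcomp Require Import all_boot all_order all_algebra.
From mathcomp Require Import all_classical all_reals all_analysis.
From mathcomp.real_closed Require Import complex.
Import numFieldNormedType.Exports.

Set Implicit Arguments.
Unset Strict Implicit.
Unset Printing Implicit Defensive.

Import Order.TTheory GRing.Theory Num.Theory.
Local Open Scope classical_set_scope.
Local Open Scope ring_scope.

(* The torus T^n, parametrized by angles measured in full turns:            *)
(* x : 'rV[R]_n stands for the point (e^{2 pi i x_0},...,e^{2 pi i x_{n-1}}). *)
(* It carries the product sigma-algebra generated by the coordinate maps.    *)

Definition coord_sets (R : realType) (n : nat) : set (set 'rV[R]_n) :=
  [set A | exists (i : 'I_n) (B : set R), measurable B /\ A = (fun x : 'rV[R]_n => x ord0 i) @^-1` B].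

Notation torus R n := (g_sigma_algebraType (@coord_sets R n)).

(* mu is the normalized Lebesgue (Haar) measure on T^n: the product of the
   Lebesgue measure restricted to [0,1) in each coordinate. Boxes form a
   generating pi-system, so this property determines mu uniquely. *)
Definition is_torus_measure (R : realType) (n : nat)
    (mu : {measure set (torus R n) -> \bar R}) : Prop :=
  forall A : 'I_n -> set R, (forall i, measurable (A i)) ->
    mu [set x | forall i, A i (x ord0 i)] =
    (\prod_(i < n) (@lebesgue_measure R) (A i `&` `[0%R, 1%R[))%E.

Section TorusDefs.
Variables (R : realType) (n : nat) (mu : {measure set (torus R n) -> \bar R}).

Local Notation C := R[i].
Local Notation T := (torus R n).
Local Open Scope complex_scope.

(* complex-valued functions on T^n *)
Definition cmeasurable (f : T -> C) : Prop :=
  measurable_fun setT (fun x => complex.Re (f x)) /\ measurable_fun setT (fun x => complex.Im (f x)).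

(* int |f|^p dmu, as an extended real *)
Definition pnorm_pow (p : nat) (f : T -> C) : \bar R :=
  (\int[mu]_x ((Normc.normc (f x)) ^+ p)%:E)%E.

(* ||f||_1 *)
Definition norm1 (f : T -> C) : \bar R := pnorm_pow 1 f.

Definition inL2 (f : T -> C) : Prop := cmeasurable f /\ (pnorm_pow 2 f < +oo)%E.

(* the integral of an (integrable) complex function *)
Definition cint (f : T -> C) : C :=
  Complex (Rintegral mu setT (fun x => complex.Re (f x)))
          (Rintegral mu setT (fun x => complex.Im (f x))).

(* L^2 inner product <f, g> *)
Definition inner (f g : T -> C) : C := cint (fun x => f x * (g x)^*).

(* t |-> e^{2 pi i t} *)
Definition e2pi (t : R) : C := Complex (cos (2 * pi * t)) (sin (2 * pi * t)).

(* the coordinate function z_i and the monomials z^k, k in Z^n *)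
Definition zcoord (i : 'I_n) : T -> C := fun x => e2pi (x ord0 i).
Definition monomial (k : 'I_n -> int) : T -> C :=
  fun x => e2pi (\sum_(i < n) (k i)%:~R * x ord0 i).

(* Fourier coefficient  \hat f(k) = int f \bar{z^k} dmu *)
Definition fourier (f : T -> C) (k : 'I_n -> int) : C :=
  cint (fun x => f x * (monomial k x)^*).

Definition in_Zplus (k : 'I_n -> int) : Prop := forall i, (0 <= k i)%R.
Definition in_Zminus (k : 'I_n -> int) : Prop := forall i, (k i <= 0)%R.

(* H^2(T^n) *)
Definition inH2 (f : T -> C) : Prop :=
  inL2 f /\ forall k, ~ in_Zplus k -> fourier f k = 0.

(* H^2_0(T^n) = {f in H^2 : f(0) = 0}; the value at the origin of the
   analytic extension is the 0-th Fourier coefficient *)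
Definition inH20 (f : T -> C) : Prop := inH2 f /\ fourier f (fun _ => 0%R) = 0.

(* M_n = L^2 (-) (conj(H^2) + H^2): closed span of monomials z^k with k having
   both a positive and a negative entry *)
Definition inMn (f : T -> C) : Prop :=
  inL2 f /\ forall k, (in_Zplus k \/ in_Zminus k) -> fourier f k = 0.

(* a.e. equality *)
Definition ae_eq (f g : T -> C) : Prop := {ae mu, forall x, f x = g x}.

(* closed linear subspace of L^2 (as a set of representatives) *)
Definition closed_subspace (S : set (T -> C)) : Prop :=
  [/\ (forall f, S f -> inL2 f),
      S (fun _ => 0),
      (forall f g, S f -> S g -> S (fun x => f x + g x)),
      (forall (c : C) f, S f -> S (fun x => c * f x)) &
      (forall (u : nat -> T -> C) f, (forall j, S (u j)) -> inL2 f ->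
         (fun j => pnorm_pow 2 (fun x => u j x - f x)) @ \oo --> 0%E -> S f)].

(* g is (a representative of) T_{z_i}^* f, where f in H^2: the adjoint of
   multiplication by z_i on H^2 *)
Definition is_Tz_adj (i : 'I_n) (f g : T -> C) : Prop :=
  inH2 g /\ forall h, inH2 h -> inner g h = inner f (fun x => zcoord i x * h x).

(* Q is a quotient module of H^2(T^n) *)
Definition quotient_module (Q : set (T -> C)) : Prop :=
  [/\ closed_subspace Q, (forall f, Q f -> inH2 f) &
      forall i f g, Q f -> is_Tz_adj i f g -> Q g].

(* g is (a representative of) P_Q f *)
Definition is_proj (Q : set (T -> C)) (f g : T -> C) : Prop :=
  Q g /\ forall h, Q h -> inner (fun x => f x - g x) h = 0.

(* X is a contraction on Q (bounded linear operator of norm <= 1),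
   represented on representatives *)
Definition contraction_on (Q : set (T -> C)) (X : (T -> C) -> (T -> C)) : Prop :=
  [/\ (forall f, Q f -> Q (X f)),
      (forall f g, Q f -> Q g -> ae_eq (X (fun x => f x + g x)) (fun x => X f x + X g x)),
      (forall (c : C) f, Q f -> ae_eq (X (fun x => c * f x)) (fun x => c * X f x)) &
      (forall f, Q f -> (pnorm_pow 2 (X f) <= pnorm_pow 2 f)%E)].

(* X S_{z_i} = S_{z_i} X  for all i, where S_{z_i} = P_Q T_{z_i}|_Q *)
Definition module_map (Q : set (T -> C)) (X : (T -> C) -> (T -> C)) : Prop :=
  forall i f g, Q f -> is_proj Q (fun x => zcoord i x * f x) g ->
    is_proj Q (fun x => zcoord i x * X f x) (X g).

(* phi in S(D^n), the closed unit ball of H^infty(D^n), given by its boundary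
   function: |phi| <= 1 a.e. and Fourier coefficients supported in Z_+^n *)
Definition in_schur (phi : T -> C) : Prop :=
  [/\ cmeasurable phi, {ae mu, forall x, Normc.normc (phi x) <= 1} &
      forall k, ~ in_Zplus k -> fourier phi k = 0].

(* X = S_phi = P_Q T_phi |_Q for some phi in S(D^n) *)
Definition liftable (Q : set (T -> C)) (X : (T -> C) -> (T -> C)) : Prop :=
  exists phi, in_schur phi /\
    forall f, Q f -> is_proj Q (fun x => phi x * f x) (X f).

(* M_Q = Q^conj + M_n + H^2_0 *)
Definition in_MQ (Q : set (T -> C)) (f : T -> C) : Prop :=
  exists q m h, [/\ Q q, inMn m, inH20 h &
    forall x, f x = (q x)^* + m x + h x].

(* X_Q f = int psi f dmu is contractive on (M_Q, ||.||_1) *)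
Definition XQ_contractive (Q : set (T -> C)) (psi : T -> C) : Prop :=
  forall f, in_MQ Q f -> ((Normc.normc (cint (fun x => psi x * f x)))%:E <= norm1 f)%E.

End TorusDefs.

(* Main.v *)
Require Import Defs.
From HB Require Import structures.
From mathcomp Require Import all_boot all_order all_algebra.
From mathcomp Require Import all_classical all_reals all_analysis.
From mathcomp Require Import measurable_realfun ring lra zify.
From mathcomp.real_closed Require Import complex.
Import numFieldNormedType.Exports.
Import Order.TTheory GRing.Theory Num.Theory.
Local Open Scope classical_set_scope.
Local Open Scope ring_scope.

(** If [X = S_phi], then [psi = X (P_Q 1)] and [phi] have the same integral
    against every [f] in [M_Q], because [phi (H2 (-) Q)] is orthogonal to [Q];
    hence [|X_Q f| <= |f|_1].  That orthogonality is clear for polynomials and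
    passes to [phi] through its Fejer means, which are bounded by 1 and converge
    weakly to [phi].

    Conversely, minimise the L2-distance between the unit ball of [L^infty] and
    the coset [psi + (H2 (-) Q)].  The minimum is attained, and the conjugate of
    the residual [w] lies in [M_Q].  Testing optimality against the sign of [w]
    gives [|w|_1 + |w|_2^2 <= |<psi, w>|], so contractivity of [X_Q] forces
    [w = 0] and produces [phi] in the Schur class with [P_Q phi = psi].  Then
    [X] and [S_phi] agree on every [P_Q z^k], and these span a dense subspace
    of [Q] by completeness of the monomials. *)

Set Implicit Arguments.
Unset Strict Implicit.
Unset Printing Implicit Defensive.

(** * Complex-valued integration *)

(** The classical route from contractivity to a symbol is Hahn-Banach together with the duality of
    L^1 and L^infty; here a least-distance problem in L2 takes their place, and its first-order
    optimality condition supplies the symbol. No weak compactness is used for the minimum: the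
    near-optimal sets are convex, nested and bounded, and their elements of nearly least norm
    converge strongly.

    Fejer means are chosen because L2 approximation of [phi] says too little about [phi g] when [g]
    is merely in L2: the approximants must also stay bounded in sup norm.

    Commutation with the compressions [S_{z_i}] enters in the passage from [P_Q 1] to [P_Q z^k]. It
    handles one coordinate at a time, the factor [z_i] being moved to the other side of an inner
    product as a backward shift, which preserves [Q].

    Functions are representatives and not classes, and [X] is linear only up to a.e. equality; for
    this reason most identities about [X] are tested by inner products against elements of [Q]. *)

Section ComplexAux.
Variable R : realType.
Local Notation C := R[i].
Local Notation "x %:C" := (real_complex R x) : ring_scope.
Implicit Types x y : C.

Lemma cReD x y : complex.Re (x + y) = complex.Re x + complex.Re y.
Proof. by case: x; case: y. Qed.
Lemma cImD x y : complex.Im (x + y) = complex.Im x + complex.Im y.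
Proof. by case: x; case: y. Qed.
Lemma cReN x : complex.Re (- x) = - complex.Re x.
Proof. by case: x. Qed.
Lemma cImN x : complex.Im (- x) = - complex.Im x.
Proof. by case: x. Qed.
Lemma cReM x y : complex.Re (x * y) =
  complex.Re x * complex.Re y - complex.Im x * complex.Im y.
Proof. by case: x; case: y. Qed.
Lemma cImM x y : complex.Im (x * y) =
  complex.Re x * complex.Im y + complex.Im x * complex.Re y.
Proof. by case: x; case: y. Qed.
Lemma cReJ x : complex.Re (x^*) = complex.Re x.
Proof. by case: x. Qed.
Lemma cImJ x : complex.Im (x^*) = - complex.Im x.
Proof. by case: x. Qed.
Definition cE := (cReD, cImD, cReN, cImN, cReM, cImM, cReJ, cImJ).

Lemma conjCR (r : R) : (r%:C)^* = r%:C :> C.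
Proof. exact: conjc_real. Qed.

Lemma conjM x y : (x * y)^* = x^* * y^*.
Proof. exact: rmorphM. Qed.
Lemma conjD x y : (x + y)^* = x^* + y^*.
Proof. exact: rmorphD. Qed.
Lemma conjB x y : (x - y)^* = x^* - y^*.
Proof. exact: rmorphB. Qed.

Lemma complexP x y :
  complex.Re x = complex.Re y -> complex.Im x = complex.Im y -> x = y.
Proof. by case: x; case: y => a b c d /= -> ->. Qed.

Lemma sqr_normc x :
  Normc.normc x ^+ 2 = complex.Re x ^+ 2 + complex.Im x ^+ 2.
Proof. by case: x => a b /=; rewrite sqr_sqrtr // addr_ge0 ?sqr_ge0. Qed.

Lemma normc_ge0 x : 0 <= Normc.normc x.
Proof. by case: x => a b /=; apply: sqrtr_ge0. Qed.

Lemma normr_Re_le x : `|complex.Re x| <= Normc.normc x.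
Proof.
rewrite -(@ler_pXn2r _ 2) ?nnegrE ?normc_ge0 //.
by rewrite real_normK ?num_real // sqr_normc lerDl sqr_ge0.
Qed.

Lemma normr_Im_le x : `|complex.Im x| <= Normc.normc x.
Proof.
rewrite -(@ler_pXn2r _ 2) ?nnegrE ?normc_ge0 //.
by rewrite real_normK ?num_real // sqr_normc lerDr sqr_ge0.
Qed.

Lemma normcJ x : Normc.normc (x^*) = Normc.normc x.
Proof. by case: x => a b /=; rewrite sqrrN. Qed.

Lemma mulcJ x : x * x^* = (Normc.normc x ^+ 2)%:C.
Proof. by apply: complexP; rewrite !cE ?sqr_normc /=; ring. Qed.

Lemma normcR (r : R) : Normc.normc (r%:C) = `|r|.
Proof. by rewrite /= expr0n addr0 sqrtr_sqr. Qed.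

Lemma normc0_eq0 x : Normc.normc x = 0 -> x = 0.
Proof. exact: Normc.eq0_normc. Qed.

Lemma normcB x y : Normc.normc (x - y) = Normc.normc (y - x).
Proof. by rewrite -opprB normcN. Qed.

(* [csgn 0 = 0], since [0^-1 = 0] *)
Definition csgn x : C := x / (Normc.normc x)%:C.

Lemma csgnE x : x * (csgn x)^* = (Normc.normc x)%:C.
Proof.
rewrite /csgn; have [->|x0] := eqVneq x 0.
  by rewrite !mul0r Normc.normc0.
have n0 : Normc.normc x != 0 by apply: contra_neq x0 => /normc0_eq0.
rewrite -(fmorphV (real_complex R)) conjM conjCR.
by rewrite mulrA mulcJ expr2 -rmorphM /= mulfK.
Qed.

Lemma normc_csgn_le x : Normc.normc (csgn x) <= 1.
Proof.
rewrite /csgn; have [->|x0] := eqVneq x 0.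
  by rewrite !mul0r Normc.normc0.
have n0 : Normc.normc x != 0 by apply: contra_neq x0 => /normc0_eq0.
by rewrite Normc.normcM Normc.normcV normcR ger0_norm ?normc_ge0 // divff.
Qed.

End ComplexAux.

Section ComplexIntegral.
Variables (R : realType) (n : nat) (mu : {measure set (torus R n) -> \bar R}).
Hypothesis mu1 : mu setT = 1%E.
Local Notation C := R[i].
Local Notation T := (torus R n).
Local Notation "x %:C" := (real_complex R x) : ring_scope.
Implicit Types f g h : T -> C.

Lemma cmeasurable_cst (c : C) : cmeasurable (fun _ : T => c).
Proof. by split; apply: measurable_cst. Qed.

Lemma cmeasurableD f g : cmeasurable f -> cmeasurable g ->
  cmeasurable (fun x => f x + g x).
Proof.
move=> [f1 f2] [g1 g2]; split; under eq_fun do rewrite cE;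
  exact: measurable_funD.
Qed.

Lemma cmeasurableM f g : cmeasurable f -> cmeasurable g ->
  cmeasurable (fun x => f x * g x).
Proof.
move=> [f1 f2] [g1 g2]; split; under eq_fun do rewrite cE.
  by apply: measurable_funB; exact: measurable_funM.
by apply: measurable_funD; exact: measurable_funM.
Qed.

Lemma cmeasurableN f : cmeasurable f -> cmeasurable (fun x => - f x).
Proof.
by move=> [f1 f2]; split; under eq_fun do rewrite cE; exact: measurable_funN.
Qed.

Lemma cmeasurableB f g : cmeasurable f -> cmeasurable g ->
  cmeasurable (fun x => f x - g x).
Proof. by move=> mf mg; apply: cmeasurableD => //; apply: cmeasurableN. Qed.

Lemma cmeasurableJ f : cmeasurable f -> cmeasurable (fun x => (f x)^*).
Proof.
move=> [f1 f2]; split; under eq_fun do rewrite cE; first exact: f1.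
exact: measurable_funN.
Qed.

Lemma measurable_normcX f p : cmeasurable f ->
  measurable_fun setT (fun x => Normc.normc (f x) ^+ p).
Proof.
move=> [f1 f2]; apply: measurable_funX.
have -> : (fun x => Normc.normc (f x)) =
   (fun x => Num.sqrt (complex.Re (f x) ^+ 2 + complex.Im (f x) ^+ 2)).
  by apply/funext => x; case: (f x).
apply: (@measurableT_comp _ _ _ _ _ _ (@Num.sqrt R)).
  by apply: continuous_measurable_fun; exact: sqrt_continuous.
by apply: measurable_funD; exact: measurable_funX.
Qed.

Lemma measurable_normc f : cmeasurable f ->
  measurable_fun setT (fun x => Normc.normc (f x)).
Proof. exact: (@measurable_normcX f 1). Qed.

Lemma cmeasurable_real (f : T -> R) : measurable_fun setT f ->
  cmeasurable (fun x => (f x)%:C).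
Proof. by move=> mf; split => //=; exact: measurable_cst. Qed.

Definition rint (f : T -> R) : Prop := mu.-integrable setT (EFin \o f).

Lemma rint_le (f g : T -> R) : measurable_fun setT f -> rint g ->
  (forall x, `|f x| <= g x) -> rint f.
Proof.
move=> mf ig fg; apply: le_integrable ig => //.
  exact/measurable_EFinP.
by move=> x _ /=; rewrite lee_fin (le_trans (fg x)) // ler_norm.
Qed.

Lemma rintD (f g : T -> R) : rint f -> rint g -> rint (fun x => f x + g x).
Proof. by move=> hf hg; apply: (integrableD _ hf hg). Qed.

Lemma rintZ (c : R) (f : T -> R) : rint f -> rint (fun x => c * f x).
Proof. by move=> hf; apply: (integrableZl _ c hf). Qed.

Lemma rintN (f : T -> R) : rint f -> rint (fun x => - f x).
Proof. by move=> hf; apply: (integrableN hf). Qed.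

Lemma rint_cst (c : R) : rint (fun _ => c).
Proof.
apply/integrableP; split; first exact: measurable_cst.
by rewrite (integral_cst mu measurableT (`|c|%:E)) mu1 mule1 ltry.
Qed.

Lemma rint_meas (f : T -> R) : rint f -> measurable_fun setT f.
Proof. by move/measurable_int/measurable_EFinP. Qed.

Definition cintegrable f : Prop :=
  rint (fun x => complex.Re (f x)) /\ rint (fun x => complex.Im (f x)).

Lemma cintegrable_meas f : cintegrable f -> cmeasurable f.
Proof. by move=> [/rint_meas ? /rint_meas ?]. Qed.

Lemma cintegrable_le f (g : T -> R) : cmeasurable f -> rint g ->
  (forall x, Normc.normc (f x) <= g x) -> cintegrable f.
Proof.
move=> [f1 f2] ig fg; split; apply: rint_le ig _ => // x.
  exact: le_trans (normr_Re_le _) (fg x).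
exact: le_trans (normr_Im_le _) (fg x).
Qed.

Lemma rint_normc f : cintegrable f -> rint (fun x => Normc.normc (f x)).
Proof.
move=> [f1 f2]; apply: (@rint_le _ (fun x => `|complex.Re (f x)| + `|complex.Im (f x)|)).
- by apply: measurable_normc; apply: cintegrable_meas; split.
- by apply: rintD; apply: integrable_norm.
- move=> x; rewrite ger0_norm ?normc_ge0 //.
  rewrite -(@ler_pXn2r _ 2) ?nnegrE ?normc_ge0 ?addr_ge0 //.
  rewrite sqr_normc -(real_normK (num_real (complex.Re _))).
  rewrite -(real_normK (num_real (complex.Im _))).
  have := normr_ge0 (complex.Re (f x)); have := normr_ge0 (complex.Im (f x)).
  by nra.
Qed.

Lemma cintegrableD f g : cintegrable f -> cintegrable g ->
  cintegrable (fun x => f x + g x).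
Proof.
by move=> [f1 f2] [g1 g2]; split; under eq_fun do rewrite cE; exact: rintD.
Qed.

Lemma cintegrableZ (c : C) f : cintegrable f -> cintegrable (fun x => c * f x).
Proof.
move=> [f1 f2]; split; under eq_fun do rewrite cE.
  by apply: rintD; [exact: rintZ|apply: rintN; exact: rintZ].
by apply: rintD; exact: rintZ.
Qed.

Lemma cintD f g : cintegrable f -> cintegrable g ->
  cint mu (fun x => f x + g x) = cint mu f + cint mu g.
Proof.
move=> [f1 f2] [g1 g2]; apply: complexP; rewrite !cE /=.
  by under eq_Rintegral do rewrite cE; rewrite RintegralD.
by under eq_Rintegral do rewrite cE; rewrite RintegralD.
Qed.

Lemma cintZ (c : C) f : cintegrable f ->
  cint mu (fun x => c * f x) = c * cint mu f.
Proof.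
move=> [f1 f2]; apply: complexP; rewrite !cE /=.
  under eq_Rintegral do rewrite cE.
  by rewrite RintegralB ?RintegralZl //; exact: rintZ.
under eq_Rintegral do rewrite cE.
by rewrite RintegralD ?RintegralZl //; exact: rintZ.
Qed.

Lemma RintegralN (f : T -> R) : rint f ->
  Rintegral mu setT (fun x => - f x) = - Rintegral mu setT f.
Proof.
move=> rf; rewrite -mulN1r -RintegralZl //.
by under eq_Rintegral do rewrite -mulN1r.
Qed.

Lemma cintJ f : cintegrable f -> cint mu (fun x => (f x)^*) = (cint mu f)^*.
Proof.
move=> [f1 f2]; apply: complexP; rewrite !cE /=.
  by under eq_Rintegral do rewrite cE.
by under eq_Rintegral do rewrite cE; rewrite RintegralN.
Qed.

Lemma cint_real (f : T -> R) : cint mu (fun x => (f x)%:C) = (Rintegral mu setT f)%:C.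
Proof.
apply: complexP => //=.
by rewrite /Rintegral integral0_eq.
Qed.

Lemma Rintegral_ae (f g : T -> R) : measurable_fun setT f ->
  measurable_fun setT g -> {ae mu, forall x, f x = g x} ->
  Rintegral mu setT f = Rintegral mu setT g.
Proof.
move=> mf mg fg; rewrite /Rintegral; congr fine.
apply: ae_eq_integral => //; try exact/measurable_EFinP.
by apply: filterS fg => x -> _.
Qed.

Lemma cint_ae f g : cmeasurable f -> cmeasurable g -> Defs.ae_eq mu f g ->
  cint mu f = cint mu g.
Proof.
move=> [f1 f2] [g1 g2] fg; rewrite /cint; congr Complex;
  apply: Rintegral_ae => //; by apply: filterS fg => x ->.
Qed.

(* Rotate the integral onto the positive real axis. *)
Lemma normc_cint_le f : cintegrable f ->
  Normc.normc (cint mu f) <= Rintegral mu setT (fun x => Normc.normc (f x)).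
Proof.
move=> intf; set c := (csgn (cint mu f))^*.
have E : cint mu (fun x => c * f x) = (Normc.normc (cint mu f))%:C.
  by rewrite cintZ // mulrC csgnE.
have -> : Normc.normc (cint mu f) = complex.Re (cint mu (fun x => c * f x)).
  by rewrite E.
have [i1 i2] := cintegrableZ c intf.
apply: le_Rintegral => //; first exact: rint_normc.
move=> x _; apply: le_trans (ler_norm _) _.
apply: le_trans (normr_Re_le _) _; rewrite Normc.normcM.
by rewrite ler_piMl ?normc_ge0 // /c normcJ normc_csgn_le.
Qed.

End ComplexIntegral.

(** * The Hilbert space L2 *)

Section L2.
Variables (R : realType) (n : nat) (mu : {measure set (torus R n) -> \bar R}).
Hypothesis mu1 : mu setT = 1%E.
Local Notation C := R[i].
Local Notation T := (torus R n).
Local Notation "x %:C" := (real_complex R x) : ring_scope.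
Local Notation inL2 := (inL2 mu).
Local Notation inner := (inner mu).
Local Notation "f =ae g" := (Defs.ae_eq mu f g) (at level 70).
Implicit Types f g h : T -> C.

Definition sqnorm f : R := Rintegral mu setT (fun x => Normc.normc (f x) ^+ 2).

Lemma inL2P f :
  inL2 f <-> cmeasurable f /\ rint mu (fun x => Normc.normc (f x) ^+ 2).
Proof.
split=> -[mf h]; split=> //.
  apply/integrableP; split; first by apply/measurable_EFinP; exact: measurable_normcX.
  move: h; rewrite /pnorm_pow; congr (_ < _)%E; apply: eq_integral => x _ /=.
  by rewrite ger0_norm // sqr_ge0.
move/integrableP: h => [_]; congr (_ < _)%E; apply: eq_integral => x _ /=.
by rewrite ger0_norm // sqr_ge0.
Qed.

Lemma L2_meas f : inL2 f -> cmeasurable f.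
Proof. by case. Qed.

Lemma L2_rint f : inL2 f -> rint mu (fun x => Normc.normc (f x) ^+ 2).
Proof. by move/inL2P => []. Qed.

Lemma pnorm2E f : inL2 f -> pnorm_pow mu 2 f = (sqnorm f)%:E.
Proof.
move=> /L2_rint h; rewrite /sqnorm /Rintegral fineK //.
exact: integrable_fin_num.
Qed.

Lemma nrm2_ge0 f : 0 <= sqnorm f.
Proof. by apply: Rintegral_ge0 => x _; rewrite sqr_ge0. Qed.

Lemma L2_le f (g : T -> R) : cmeasurable f -> rint mu g ->
  (forall x, Normc.normc (f x) ^+ 2 <= g x) -> inL2 f.
Proof.
move=> mf ig fg; apply/inL2P; split=> //; apply: rint_le ig _.
  exact: measurable_normcX.
by move=> x; rewrite ger0_norm ?sqr_ge0.
Qed.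

Lemma L2_bounded f (M : R) : cmeasurable f ->
  (forall x, Normc.normc (f x) <= M) -> inL2 f.
Proof.
move=> mf fM; apply: (L2_le mf (rint_cst mu1 (M ^+ 2))) => x.
by rewrite lerXn2r ?nnegrE ?normc_ge0 // (le_trans _ (fM x)) ?normc_ge0.
Qed.

Lemma L2_cst (c : C) : inL2 (fun _ => c).
Proof. by apply: (@L2_bounded _ (Normc.normc c)) => //; exact: cmeasurable_cst. Qed.

Lemma L2D f g : inL2 f -> inL2 g -> inL2 (fun x => f x + g x).
Proof.
move=> hf hg; apply: (@L2_le _ (fun x => 2 * Normc.normc (f x) ^+ 2 +
    2 * Normc.normc (g x) ^+ 2)).
- by apply: cmeasurableD; exact: L2_meas.
- by apply: rintD; apply: rintZ; exact: L2_rint.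
- move=> x; have h := le_normcD (f x) (g x).
  apply: (@le_trans _ _ ((Normc.normc (f x) + Normc.normc (g x)) ^+ 2)).
    by rewrite lerXn2r ?nnegrE ?addr_ge0 ?normc_ge0.
  by have := sqr_ge0 (Normc.normc (f x) - Normc.normc (g x)); nra.
Qed.

Lemma L2Z (c : C) f : inL2 f -> inL2 (fun x => c * f x).
Proof.
move=> hf; apply: (@L2_le _ (fun x => Normc.normc c ^+ 2 * Normc.normc (f x) ^+ 2)).
- by apply: cmeasurableM; [exact: cmeasurable_cst|exact: L2_meas].
- by apply: rintZ; exact: L2_rint.
- by move=> x; rewrite Normc.normcM exprMn.
Qed.

Lemma L2N f : inL2 f -> inL2 (fun x => - f x).
Proof. by move=> /(@L2Z (-1)); under eq_fun do rewrite mulN1r. Qed.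

Lemma L2B f g : inL2 f -> inL2 g -> inL2 (fun x => f x - g x).
Proof. by move=> hf hg; apply: L2D => //; exact: L2N. Qed.

Lemma L2J f : inL2 f -> inL2 (fun x => (f x)^*).
Proof.
move=> hf; apply: L2_le (L2_rint hf) _; first exact/cmeasurableJ/L2_meas.
by move=> x; rewrite normcJ.
Qed.

(** A Schur function is bounded by 1 only almost everywhere, so the comparison is made between
    extended integrals and then read back as finite numbers. *)
Lemma L2M_ae f g : cmeasurable g -> {ae mu, forall x, Normc.normc (g x) <= 1} ->
  inL2 f -> inL2 (fun x => g x * f x) /\ sqnorm (fun x => g x * f x) <= sqnorm f.
Proof.
move=> mg g1 hf; have [mf fo] := hf.
have le : (pnorm_pow mu 2 (fun x => g x * f x)%R <= pnorm_pow mu 2 f)%E.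
  have m1 : measurable_fun setT (fun x => (Normc.normc (g x * f x) ^+ 2)%:E).
    by apply/measurable_EFinP; apply: measurable_normcX; exact: cmeasurableM.
  have m2 : measurable_fun setT (fun x => (Normc.normc (f x) ^+ 2)%:E).
    by apply/measurable_EFinP; exact: measurable_normcX.
  apply: ae_ge0_le_integral => //; try by move=> x _; rewrite lee_fin sqr_ge0.
  apply: filterS g1 => x g1 _; rewrite lee_fin lerXn2r ?nnegrE ?normc_ge0 //.
  by rewrite Normc.normcM ler_piMl ?normc_ge0.
have h : inL2 (fun x => g x * f x).
  by split; [exact: cmeasurableM|apply: le_lt_trans le _].
by split=> //; move: le; rewrite !pnorm2E // lee_fin.
Qed.

Lemma L2M_bounded f g : cmeasurable g -> (forall x, Normc.normc (g x) <= 1) ->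
  inL2 f -> inL2 (fun x => g x * f x).
Proof.
by move=> mg g1 hf; apply: (L2M_ae mg _ hf).1; apply: nearW.
Qed.

Lemma L2_mul f g : inL2 f -> inL2 g -> cintegrable mu (fun x => f x * g x).
Proof.
move=> hf hg; apply: (@cintegrable_le _ _ mu _ (fun x => Normc.normc (f x) ^+ 2 +
    Normc.normc (g x) ^+ 2)).
- by apply: cmeasurableM; exact: L2_meas.
- by apply: rintD; exact: L2_rint.
- move=> x; rewrite Normc.normcM.
  have := normc_ge0 (f x); have := normc_ge0 (g x).
  by have := sqr_ge0 (Normc.normc (f x) - Normc.normc (g x)); nra.
Qed.

Lemma L2_mulJ f g : inL2 f -> inL2 g -> cintegrable mu (fun x => f x * (g x)^*).
Proof. by move=> hf hg; apply: L2_mul => //; exact: L2J. Qed.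

Lemma inner_addl f g h : inL2 f -> inL2 g -> inL2 h ->
  inner (fun x => f x + g x) h = inner f h + inner g h.
Proof.
move=> hf hg hh; rewrite /Defs.inner -cintD; try exact: L2_mulJ.
by congr cint; apply/funext => x; rewrite mulrDl.
Qed.

Lemma inner_scalel c f h : inL2 f -> inL2 h ->
  inner (fun x => c * f x) h = c * inner f h.
Proof.
move=> hf hh; rewrite /Defs.inner -cintZ; last exact: L2_mulJ.
by congr cint; apply/funext => x; rewrite mulrA.
Qed.

Lemma inner_conj f g : inL2 f -> inL2 g -> inner g f = (inner f g)^*.
Proof.
move=> hf hg; rewrite /Defs.inner -cintJ; last exact: L2_mulJ.
by congr cint; apply/funext => x; rewrite conjM conjCK mulrC.
Qed.

Lemma inner_subl f g h : inL2 f -> inL2 g -> inL2 h ->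
  inner (fun x => f x - g x) h = inner f h - inner g h.
Proof.
move=> hf hg hh; rewrite (inner_addl hf (L2N hg) hh); congr (_ + _).
rewrite -mulN1r -inner_scalel //; congr Defs.inner.
by apply/funext => x; rewrite mulN1r.
Qed.

Lemma inner_addr f g h : inL2 f -> inL2 g -> inL2 h ->
  inner h (fun x => f x + g x) = inner h f + inner h g.
Proof.
move=> hf hg hh; rewrite (inner_conj (L2D hf hg) hh) inner_addl // conjD.
by rewrite -!inner_conj.
Qed.

Lemma inner_subr f g h : inL2 f -> inL2 g -> inL2 h ->
  inner h (fun x => f x - g x) = inner h f - inner h g.
Proof.
move=> hf hg hh; rewrite (inner_conj (L2B hf hg) hh) inner_subl // conjB.
by rewrite -!inner_conj.
Qed.

Lemma inner_scaler c f h : inL2 f -> inL2 h ->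
  inner h (fun x => c * f x) = c^* * inner h f.
Proof.
move=> hf hh; rewrite (inner_conj (L2Z c hf) hh) inner_scalel // conjM.
by rewrite -!inner_conj.
Qed.

Lemma inner_ae f g f' g' : cmeasurable f -> cmeasurable g ->
  cmeasurable f' -> cmeasurable g' -> f =ae f' -> g =ae g' ->
  inner f g = inner f' g'.
Proof.
move=> hf hg hf' hg' ff gg; apply: cint_ae.
- by apply: cmeasurableM => //; exact: cmeasurableJ.
- by apply: cmeasurableM => //; exact: cmeasurableJ.
- by apply: filterS2 ff gg => x -> ->.
Qed.

Lemma inner_nrm2 f : inner f f = (sqnorm f)%:C.
Proof.
rewrite /sqnorm -cint_real; congr cint; apply/funext => x; exact: mulcJ.
Qed.

Lemma nrm2D f g : inL2 f -> inL2 g ->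
  sqnorm (fun x => f x + g x) = sqnorm f + sqnorm g + 2 * complex.Re (inner f g).
Proof.
move=> hf hg; apply: (@complexI R); rewrite -inner_nrm2.
have hfg := L2D hf hg.
rewrite inner_addl // !inner_addr // (inner_conj hf hg) !inner_nrm2.
by apply: complexP; rewrite !cE /=; ring.
Qed.

Lemma nrm2Z c f : inL2 f ->
  sqnorm (fun x => c * f x) = Normc.normc c ^+ 2 * sqnorm f.
Proof.
move=> hf; apply: (@complexI R); rewrite -inner_nrm2.
rewrite inner_scalel ?inner_scaler ?mulrA ?mulcJ ?inner_nrm2 //; last exact: L2Z.
by rewrite -rmorphM.
Qed.

Lemma nrm2N f : sqnorm (fun x => - f x) = sqnorm f.
Proof. by rewrite /sqnorm; under eq_Rintegral do rewrite normcN. Qed.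

Lemma nrm2BC f g : sqnorm (fun x => f x - g x) = sqnorm (fun x => g x - f x).
Proof. by rewrite /sqnorm; under eq_Rintegral do rewrite normcB. Qed.

Lemma nrm2_ae f g : cmeasurable f -> cmeasurable g -> f =ae g -> sqnorm f = sqnorm g.
Proof.
move=> hf hg fg; apply: Rintegral_ae; try exact: measurable_normcX.
by apply: filterS fg => x ->.
Qed.

Lemma nrm2B f g : inL2 f -> inL2 g ->
  sqnorm (fun x => f x - g x) = sqnorm f + sqnorm g - 2 * complex.Re (inner f g).
Proof.
move=> hf hg; rewrite (nrm2D hf (L2N hg)) nrm2N.
rewrite (_ : inner f (fun x => - g x) = - inner f g) ?cE ?mulrN //.
rewrite (inner_conj (L2N hg) hf) (inner_conj hg hf) -[RHS]rmorphN.
rewrite -mulN1r -inner_scalel //; congr (Num.conj (Defs.inner _ _ _)).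
by apply/funext => x; rewrite mulN1r.
Qed.

Lemma parallelogram f g : inL2 f -> inL2 g ->
  sqnorm (fun x => f x + g x) + sqnorm (fun x => f x - g x) =
  2 * sqnorm f + 2 * sqnorm g.
Proof. by move=> hf hg; rewrite nrm2D // nrm2B //; ring. Qed.

(** Positivity of |f - t s g|^2 with s = <f, g> is a real quadratic inequality in t; the factor s
    turns the cross term into |s|^2. *)
Lemma cauchy_schwarz f g : inL2 f -> inL2 g ->
  Normc.normc (inner f g) ^+ 2 <= sqnorm f * sqnorm g.
Proof.
move=> hf hg; set s := inner f g; set q := Normc.normc s ^+ 2.
have q0 : 0 <= q by rewrite sqr_ge0.
have key t : 0 <= sqnorm f - 2 * t * q + t ^+ 2 * q * sqnorm g.
  have := nrm2_ge0 (fun x => f x - (t%:C * s) * g x).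
  have hs := L2Z (t%:C * s) hg.
  rewrite nrm2B // nrm2Z // inner_scaler // -/s !conjM conjCR -mulrA (mulrC s^*) mulcJ -/q.
  rewrite Normc.normcM normcR exprMn -/q real_normK ?num_real // !cE /=.
  by rewrite !(mul0r, mulr0, subr0); lra.
have [b0|b0] := eqVneq (sqnorm g) 0.
  (* When |g| = 0 the quadratic is affine in t, and this t would give it the value -1 if q were
     nonzero. *)
  rewrite b0 mulr0; have := key ((sqnorm f + 1) / 2 / q); rewrite b0 mulr0 addr0.
  have [->//|qn] := eqVneq q 0.
  rewrite (_ : 2 * _ * q = sqnorm f + 1); first by lra.
  by field.
have bp : 0 < sqnorm g by rewrite lt_neqAle eq_sym b0 nrm2_ge0.
(* The minimum of the quadratic. *)
have := key (sqnorm g)^-1.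
rewrite (_ : _ + _ = sqnorm f - q / sqnorm g); last by field.
by rewrite subr_ge0 ler_pdivrMr.
Qed.

(** [sqnorm] obeys the exact algebraic identities; the root is introduced for the triangle
    inequality. *)
Definition L2norm f : R := Num.sqrt (sqnorm f).

Lemma nrm_ge0 f : 0 <= L2norm f. Proof. exact: sqrtr_ge0. Qed.

Lemma sqr_nrm f : L2norm f ^+ 2 = sqnorm f.
Proof. by rewrite sqr_sqrtr // nrm2_ge0. Qed.

Lemma inner_le f g : inL2 f -> inL2 g ->
  Normc.normc (inner f g) <= L2norm f * L2norm g.
Proof.
move=> hf hg; rewrite -(@ler_pXn2r _ 2) ?nnegrE ?normc_ge0 ?mulr_ge0 ?nrm_ge0 //.
by rewrite exprMn !sqr_nrm cauchy_schwarz.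
Qed.

Lemma nrmD f g : inL2 f -> inL2 g ->
  L2norm (fun x => f x + g x) <= L2norm f + L2norm g.
Proof.
move=> hf hg; rewrite -(@ler_pXn2r _ 2) ?nnegrE ?addr_ge0 ?nrm_ge0 //.
rewrite sqr_nrm nrm2D // -!sqr_nrm.
have := inner_le hf hg; have := normr_Re_le (inner f g).
by have := ler_norm (complex.Re (inner f g)); nra.
Qed.

Lemma nrmN f : L2norm (fun x => - f x) = L2norm f.
Proof. by rewrite /L2norm nrm2N. Qed.

Lemma nrmB f g : inL2 f -> inL2 g ->
  L2norm (fun x => f x - g x) <= L2norm f + L2norm g.
Proof. by move=> hf hg; rewrite -(nrmN g); apply: nrmD => //; exact: L2N. Qed.

Lemma nrmBC f g : L2norm (fun x => f x - g x) = L2norm (fun x => g x - f x).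
Proof. by rewrite /L2norm nrm2BC. Qed.

Lemma nrmB_tri f g h : inL2 f -> inL2 g -> inL2 h ->
  L2norm (fun x => f x - h x) <= L2norm (fun x => f x - g x) + L2norm (fun x => g x - h x).
Proof.
move=> hf hg hh.
rewrite (_ : (fun x => f x - h x) = (fun x => (f x - g x) + (g x - h x))).
  by apply: nrmD; exact: L2B.
by apply/funext => x; ring.
Qed.

Lemma nrmZ c f : inL2 f -> L2norm (fun x => c * f x) = Normc.normc c * L2norm f.
Proof.
by move=> hf; rewrite /L2norm nrm2Z // sqrtrM ?sqr_ge0 // sqrtr_sqr ger0_norm ?normc_ge0.
Qed.

Lemma nrm2_eq0 f : inL2 f -> sqnorm f = 0 -> f =ae (fun _ => 0).
Proof.
move=> hf f0.
have : (\int[mu]_x `|(Normc.normc (f x) ^+ 2)%:E| = 0)%E.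
  under eq_integral do rewrite /= ger0_norm ?sqr_ge0 //.
  by have := pnorm2E hf; rewrite /pnorm_pow => ->; rewrite f0.
have mf : measurable_fun setT (fun x => (Normc.normc (f x) ^+ 2)%:E).
  by apply/measurable_EFinP; apply: measurable_normcX; exact: L2_meas.
move/(ae_eq_integral_abs mu measurableT mf).
by apply: filterS => x /(_ I) [] /eqP; rewrite sqrf_eq0 => /eqP /normc0_eq0.
Qed.

Lemma L2_ae f g : cmeasurable g -> inL2 f -> f =ae g -> inL2 g.
Proof.
move=> mg [mf ff] fg; split=> //; move: ff; congr (_ < _)%E.
rewrite /pnorm_pow; apply: ae_eq_integral => //.
- by apply/measurable_EFinP; exact: measurable_normcX.
- by apply/measurable_EFinP; exact: measurable_normcX.
- by apply: filterS fg => x -> _.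
Qed.

Lemma nrm2_0 : sqnorm (fun _ => 0) = 0.
Proof.
rewrite /sqnorm (_ : (fun _ => _) = cst 0); last first.
  by apply/funext => x; rewrite Normc.normc0 expr0n.
by rewrite /Rintegral integral0.
Qed.

End L2.

(** * Completeness and projections *)

Section Hilbert.
Variables (R : realType) (n : nat) (mu : {measure set (torus R n) -> \bar R}).
Hypothesis mu1 : mu setT = 1%E.
Local Notation C := R[i].
Local Notation T := (torus R n).
Local Notation "x %:C" := (real_complex R x) : ring_scope.
Local Notation inL2 := (inL2 mu).
Local Notation inner := (inner mu).
Local Notation nrm2 := (sqnorm mu).
Local Notation nrm := (L2norm mu).
Local Notation "f =ae g" := (Defs.ae_eq mu f g) (at level 70).
Implicit Types f g h : T -> C.

Lemma cvg_sqr_normc (z : nat -> C) (w : C) :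
  complex.Re (z j) @[j --> \oo] --> complex.Re w ->
  complex.Im (z j) @[j --> \oo] --> complex.Im w ->
  Normc.normc (z j) ^+ 2 @[j --> \oo] --> Normc.normc w ^+ 2.
Proof.
move=> h1 h2; under eq_fun do rewrite sqr_normc !expr2.
by rewrite sqr_normc !expr2; apply: cvgD; exact: cvgM.
Qed.

(** Fatou's lemma on squared moduli gives membership in L2 and the bound together; this is how a
    Cauchy estimate is carried to the limit. *)
Lemma fatou_nrm2 (v : nat -> T -> C) f (c : R) :
  (forall j, inL2 (v j)) ->
  (forall x, complex.Re (v j x) @[j --> \oo] --> complex.Re (f x)) ->
  (forall x, complex.Im (v j x) @[j --> \oo] --> complex.Im (f x)) ->
  (forall j, nrm2 (v j) <= c) -> inL2 f /\ nrm2 f <= c.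
Proof.
move=> hv h1 h2 hc.
have mf : cmeasurable f.
  split.
    apply: (@measurable_fun_cvg _ _ _ _ (fun j x => complex.Re (v j x))) => //.
    by move=> j; exact: (L2_meas (hv j)).1.
  apply: (@measurable_fun_cvg _ _ _ _ (fun j x => complex.Im (v j x))) => //.
  by move=> j; exact: (L2_meas (hv j)).2.
have le : (pnorm_pow mu 2 f <= c%:E)%E.
  pose F j x : \bar R := (Normc.normc (v j x) ^+ 2)%:E.
  have FE x : limn_einf (F^~ x) = (Normc.normc (f x) ^+ 2)%:E.
    apply: (cvg_limn_einf_sup _).1; apply: cvg_EFin; first exact: nearW.
    exact: cvg_sqr_normc.
  rewrite /pnorm_pow; under eq_integral do rewrite -FE.
  apply: le_trans (@fatou _ _ _ mu _ measurableT F _ _) _.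
  - move=> j; apply/measurable_EFinP; apply: measurable_normcX.
    exact: (L2_meas (hv j)).
  - by move=> j x _; rewrite lee_fin sqr_ge0.
  rewrite limn_einf_lim; apply: lime_le; first exact: is_cvg_einfs.
  apply: nearW => j.
  have -> : (fun j => (\int[mu]_x F j x)%E) = (fun j => (nrm2 (v j))%:E).
    by apply/funext => i; rewrite -pnorm2E.
  apply: (@le_trans _ _ (nrm2 (v j))%:E); last by rewrite lee_fin.
  by apply: ereal_inf_lbound; exists j => //=.
have hf : inL2 f by split=> //; apply: le_lt_trans le _; rewrite ltry.
by split=> //; rewrite -lee_fin -pnorm2E.
Qed.

(** Adding up all thresholds [N 0 + ... + N j] makes the indices monotone without recursion, and the
    extra term [j] keeps them above the identity. *)
Lemma fast_subsequence (e d : nat -> R) : e j @[j --> \oo] --> 0 ->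
  (forall j, 0 < d j) ->
  exists phi : nat -> nat,
    [/\ forall j, (j <= phi j)%N, {homo phi : i j / (i <= j)%N} &
        forall j, e (phi j) <= d j].
Proof.
move=> e0 d0.
have /choice[N hN] : forall j, exists N, forall m, (N <= m)%N -> e m <= d j.
  by move=> j; have [N _ h] := cvgr_le _ e0 _ (d0 j); exists N => m; apply: h.
exists (fun j => j + \sum_(l < j.+1) N l)%N; split.
- by move=> j; exact: leq_addr.
- move=> i j /subnK <-; elim: (j - i)%N => // m IH; apply: leq_trans IH _.
  by rewrite addSn [in leqRHS]big_ord_recr /= leq_add ?leqnSn ?leq_addr.
- move=> j; apply: hN; rewrite big_ord_recr /= addnA; exact: leq_addl.
Qed.

(** The inequality a <= a^2 / (2 d) + d / 2 is integrated over a space of mass 1; both terms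
    contribute at most d / 2. *)
Lemma nrm1_le_nrm2 f (d : R) : 0 < d -> inL2 f -> nrm2 f <= d ^+ 2 ->
  (\int[mu]_x (Normc.normc (f x))%:E <= d%:E)%E.
Proof.
move=> d0 hf fd.
have i2 := rintZ (d^-1 / 2) (L2_rint hf).
have ic : rint mu (fun x => (d^-1 / 2) * Normc.normc (f x) ^+ 2 + d / 2).
  by apply: rintD => //; exact: rint_cst.
have pt x : Normc.normc (f x) <= (d^-1 / 2) * Normc.normc (f x) ^+ 2 + d / 2.
  rewrite -subr_ge0.
  rewrite (_ : _ - _ = (d^-1 / 2) * (Normc.normc (f x) - d) ^+ 2); last by field; lra.
  by rewrite mulr_ge0 ?sqr_ge0 // divr_ge0 // invr_ge0 ltW.
have i1 : rint mu (fun x => Normc.normc (f x)).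
  apply: rint_le ic _; first by apply: measurable_normc; exact: L2_meas hf.
  by move=> x; rewrite ger0_norm ?normc_ge0.
rewrite -[leLHS]fineK; last exact: integrable_fin_num.
rewrite lee_fin; apply: le_trans (le_Rintegral measurableT i1 ic _) _ => //.
rewrite RintegralD //; last exact: rint_cst.
rewrite (@RintegralZl _ _ _ mu setT _ (d^-1 / 2) measurableT (L2_rint hf)).
rewrite Rintegral_cst // mu1 /= mulr1 -/(sqnorm mu f).
have e : d^-1 / 2 * d ^+ 2 + d / 2 = d by field; lra.
by rewrite -[leRHS]e lerD2r ler_wpM2l // divr_ge0 // invr_ge0 ltW.
Qed.

Lemma bounded_series_cvg (w : nat -> C) :
  (\sum_(0 <= j <oo) (Normc.normc (w j))%:E < +oo)%E ->
  cvgn (series (fun j => complex.Re (w j))) /\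
  cvgn (series (fun j => complex.Im (w j))).
Proof.
move=> fin; set G := (\sum_(0 <= j <oo) _)%E in fin.
have Gf : G \is a fin_num.
  by rewrite ge0_fin_numE // nneseries_ge0 // => j _ _; rewrite lee_fin normc_ge0.
have cN : cvgn (series (fun j => Normc.normc (w j))).
  apply: nondecreasing_is_cvgn.
    by apply: nondecreasing_series => j _ _; exact: normc_ge0.
  exists (fine G) => _ [k _ <-]; rewrite -lee_fin fineK // /series /= -sumEFin.
  by apply: nneseries_lim_ge => j _ _; rewrite lee_fin normc_ge0.
split; apply: normed_cvg.
  apply: (@series_le_cvg _ (fun j => `|complex.Re (w j)|) _ _ _ _ cN) => j.
  - exact: normr_ge0.
  - exact: normc_ge0.
  - exact: normr_Re_le.
apply: (@series_le_cvg _ (fun j => `|complex.Im (w j)|) _ _ _ _ cN) => j.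
- exact: normr_ge0.
- exact: normc_ge0.
- exact: normr_Im_le.
Qed.

(** Riesz-Fischer: along a fast subsequence the increments have summable L1 norms, so they are
    absolutely summable almost everywhere. Fatou then turns the pointwise limit into an L2 limit
    with the same rate [e]. *)
Lemma L2_complete (u : nat -> T -> C) (e : nat -> R) :
  (forall j, inL2 (u j)) ->
  (forall i j, (i <= j)%N -> nrm2 (fun x => u i x - u j x) <= e i) ->
  e j @[j --> \oo] --> 0 ->
  exists f, inL2 f /\ forall i, nrm2 (fun x => u i x - f x) <= e i.
Proof.
(* The weights 2^-(j+1) add up to 1, which bounds the integral of the sum [G] of all increments. *)
move=> hu ue e0; pose d j : R := 1 / (2 ^ j.+1)%:R.
have d0 j : 0 < d j by rewrite divr_gt0 // ltr0n expn_gt0.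
have [|phi [phij phim phie]] := @fast_subsequence e (fun j => d j ^+ 2) e0.
  by move=> j; rewrite exprn_gt0.
pose v j := u (phi j); pose w j x := v j.+1 x - v j x.
have hw j : inL2 (w j) by apply: L2B; exact: hu.
have wd j : (\int[mu]_x (Normc.normc (w j x))%:E <= (d j)%:E)%E.
  apply: nrm1_le_nrm2 => //; rewrite /w nrm2BC.
  by apply: le_trans (phie j); apply: ue; apply: phim.
pose G x := (\sum_(0 <= j <oo) (Normc.normc (w j x))%:E)%E.
have w0 j x : (0 <= (Normc.normc (w j x))%:E)%E by rewrite lee_fin normc_ge0.
have mw j : measurable_fun setT (fun x => (Normc.normc (w j x))%:E).
  by apply/measurable_EFinP; apply: measurable_normc; exact: L2_meas (hw j).
have mG : measurable_fun setT G.
  exact: (@ge0_emeasurable_sum _ _ _ setT (fun j x => (Normc.normc (w j x))%:E) xpredT).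
have iG : (\int[mu]_x G x <= 1%:E)%E.
  rewrite integral_nneseries //; apply: le_trans (epsilon_trick0 xpredT ler01).
  by apply: lee_nneseries => // j _ _; exact: integral_ge0.
have G0 x : (0 <= G x)%E by apply: nneseries_ge0.
have Gfin : {ae mu, forall x, (G x < +oo)%E}.
  have : mu.-integrable setT G.
    apply/integrableP; split=> //.
    under eq_integral do rewrite gee0_abs //.
    by apply: le_lt_trans iG _; rewrite ltry.
  move/(integrable_ae measurableT); apply: filterS => x /(_ I).
  by rewrite ge0_fin_numE.
pose A := [set x | (G x < +oo)%E].
have mA : measurable A.
  by have := emeasurable_fun_infty_o measurableT mG +oo%E; rewrite setTI.
(* Setting the functions to 0 off the convergence set makes them converge at every point, as
   [fatou_nrm2] requires, without changing their classes. *)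
pose v' j x : C := (\1_A x : R)%:C * v j x.
have v'v j : v' j =ae v j.
  apply: filterS Gfin => x Gx; rewrite /v' indicE mem_set //= mul1r.
  by [].
have mv' j : cmeasurable (v' j).
  apply: cmeasurableM; last exact/L2_meas/hu.
  by apply: cmeasurable_real; exact: measurable_indic.
have hv' j : inL2 (v' j).
  apply: (L2_ae (mv' j) (hu (phi j))).
  by apply: filterS (v'v j) => x ->.
have cv x : cvgn (fun j => complex.Re (v' j x)) /\ cvgn (fun j => complex.Im (v' j x)).
  have [xA|xA] := pselect (A x); last first.
    have E j : v' j x = 0 by rewrite /v' indicE memNset //= mul0r.
    by split; under eq_fun do rewrite E; exact: is_cvg_cst.
  have E j : v' j x = v j x by rewrite /v' indicE mem_set //= mul1r.
  have [c1 c2] := @bounded_series_cvg (w^~ x) xA.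
  split.
    have -> : (fun j => complex.Re (v' j x)) =
        (fun j => complex.Re (v 0%N x) + series (fun j => complex.Re (w j x)) j).
      apply/funext => j; rewrite E.
      rewrite (eq_sum_telescope (fun j => complex.Re (v j x)) j); congr (_ + series _ _).
      by apply/funext => i; rewrite /telescope /= /w !cE.
    by apply: is_cvgD => //; exact: is_cvg_cst.
  have -> : (fun j => complex.Im (v' j x)) =
      (fun j => complex.Im (v 0%N x) + series (fun j => complex.Im (w j x)) j).
    apply/funext => j; rewrite E.
    rewrite (eq_sum_telescope (fun j => complex.Im (v j x)) j); congr (_ + series _ _).
    by apply/funext => i; rewrite /telescope /= /w !cE.
  by apply: is_cvgD => //; exact: is_cvg_cst.
pose f x : C := Complex (limn (fun j => complex.Re (v' j x)))
                    (limn (fun j => complex.Im (v' j x))).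
have key i : inL2 (fun x => u i x - f x) /\ nrm2 (fun x => u i x - f x) <= e i.
  (* The shift by [i] puts the index [phi (j + i)] beyond [i], where the Cauchy bound [e i]
     applies. *)
  apply: (@fatou_nrm2 (fun j x => u i x - v' (j + i)%N x)).
  - by move=> j; apply: L2B.
  - move=> x; under eq_fun do rewrite cReD cReN; rewrite cReD cReN; apply: cvgB; first exact: cvg_cst.
    have c : (fun j => complex.Re (v' j x)) @ \oo --> complex.Re (f x).
      exact: (cv x).1.
    by move: c; rewrite -(cvg_shiftn i); exact.
  - move=> x; under eq_fun do rewrite cImD cImN; rewrite cImD cImN; apply: cvgB; first exact: cvg_cst.
    have c : (fun j => complex.Im (v' j x)) @ \oo --> complex.Im (f x).
      exact: (cv x).2.
    by move: c; rewrite -(cvg_shiftn i); exact.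
  - move=> j; rewrite (@nrm2_ae _ _ _ _ (fun x => u i x - v (j + i)%N x)).
    + by apply: ue; apply: leq_trans (phij _); exact: leq_addl.
    + by apply: cmeasurableB => //; exact/L2_meas/hu.
    + by apply: cmeasurableB => //; exact/L2_meas/hu.
    + by apply: filterS (v'v (j + i)%N) => x ->.
exists f; split; last by move=> i; exact: (key i).2.
have := L2B (hu 0%N) (key 0%N).1; congr Defs.inL2.
by apply/funext => x; rewrite opprB addrC subrK.
Qed.

Lemma nrm_cvg0 (u : nat -> T -> C) :
  nrm2 (u j) @[j --> \oo] --> 0 -> nrm (u j) @[j --> \oo] --> 0.
Proof.
move=> h; rewrite -(sqrtr0 R); apply: (cvg_comp _ _ h); exact: sqrt_continuous.
Qed.

Lemma nrm2_lim_le (u : nat -> T -> C) f (c : nat -> R) (l : R) :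
  (forall j, inL2 (u j)) -> inL2 f ->
  nrm2 (fun x => u j x - f x) @[j --> \oo] --> 0 ->
  (forall j, nrm2 (u j) <= c j) -> c j @[j --> \oo] --> l -> nrm2 f <= l.
Proof.
move=> hu hf uf uc cl.
have c0 j : 0 <= c j by apply: le_trans (uc j); exact: nrm2_ge0.
have l0 : 0 <= l.
  by apply: (ler_cvg_to (cvg_cst 0) cl); apply: nearW.
have h : nrm f <= Num.sqrt l.
  have c1 : nrm (fun x => u j x - f x) + Num.sqrt (c j) @[j --> \oo] --> 0 + Num.sqrt l.
    apply: cvgD; first exact: (@nrm_cvg0 (fun j x => u j x - f x)).
    by apply: (cvg_comp _ _ cl); exact: sqrt_continuous.
  rewrite -[leRHS]add0r; apply: (ler_cvg_to (cvg_cst (nrm f)) c1).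
  apply: nearW => j.
  apply: (@le_trans _ _ (nrm (fun x => u j x - f x) + nrm (u j))).
    rewrite nrmBC.
    rewrite [in leLHS](_ : f = (fun x => (f x - u j x) + u j x)).
      by apply: nrmD => //; exact: L2B.
    by apply/funext => x; rewrite subrK.
  by rewrite lerD2l /L2norm ler_sqrt.
rewrite -sqr_nrm -[leRHS]sqr_sqrtr //.
by rewrite lerXn2r ?nnegrE ?nrm_ge0 ?sqrtr_ge0.
Qed.

(** Parallelogram law in midpoint form: the last term is what converts near minimality into
    closeness. *)
Lemma nrm2_mid f g : inL2 f -> inL2 g ->
  nrm2 (fun x => (2^-1)%:C * (f x + g x)) =
  (nrm2 f + nrm2 g) / 2 - nrm2 (fun x => f x - g x) / 4.
Proof.
move=> hf hg; rewrite (nrm2Z _ (L2D hf hg)) normcR.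
have -> : nrm2 (fun x => f x + g x) =
   2 * nrm2 f + 2 * nrm2 g - nrm2 (fun x => f x - g x).
  by rewrite -(parallelogram hf hg) addrK.
have -> : `|2^-1| = 2^-1 :> R by rewrite ger0_norm // invr_ge0.
by field.
Qed.

(* Almost norm-minimal points of the sets form a Cauchy sequence by the
   parallelogram law, since the minimal norms increase to a finite limit. *)
Lemma nested_convex (K : nat -> set (T -> C)) (M : R) :
  (forall j f, K j f -> inL2 f) -> (forall j f, K j f -> nrm2 f <= M) ->
  (forall j, exists f, K j f) -> (forall j f, K j.+1 f -> K j f) ->
  (forall j f g, K j f -> K j g -> K j (fun x => (2^-1)%:C * (f x + g x))) ->
  exists (u : nat -> T -> C) f, [/\ forall j, K j (u j), inL2 f &
    nrm2 (fun x => u j x - f x) @[j --> \oo] --> 0].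
Proof.
move=> K2 KM Kn Kd Kc.
have Kdd i j f : (i <= j)%N -> K j f -> K i f.
  move=> /subnK <-; elim: (j - i)%N => [//|m IH] /=.
  by rewrite addSn => /Kd; exact: IH.
pose d j := inf [set nrm2 f | f in K j].
have hinf j : has_inf [set nrm2 f | f in K j].
  split; first by have [f Kf] := Kn j; exists (nrm2 f), f.
  by exists 0 => _ [f _ <-]; exact: nrm2_ge0.
have dle j f : K j f -> d j <= nrm2 f.
  by move=> Kf; apply: ge_inf; [exact: (hinf j).2|exists f].
have dM j : d j <= M.
  by have [f Kf] := Kn j; apply: le_trans (dle _ _ Kf) (KM _ _ Kf).
have dnd : {homo d : i j / (i <= j)%N >-> i <= j}.
  move=> i j ij; apply: lb_le_inf; first exact: (hinf j).1.
  by move=> _ [f Kf <-]; apply: dle; exact: Kdd Kf.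
have dub : has_ubound (range d) by exists M => _ [j _ <-].
pose s := sup (range d).
have ds j : d j <= s by apply: ub_le_sup => //; exists j.
have dcv : d j @[j --> \oo] --> s by exact: nondecreasing_cvgn.
have /choice[u hu] : forall j, exists f, K j f /\ nrm2 f < d j + j.+1%:R^-1.
  move=> j; have [|_ [f Kf <-] h] := @inf_adherent _ _ j.+1%:R^-1 _ (hinf j).
    by rewrite invr_gt0 ltr0Sn.
  by exists f.
have u2 j : inL2 (u j) by apply: (K2 j); exact: (hu j).1.
(* For i <= j both points lie in [K i], so their midpoint has squared norm at least [d i]. This
   bounds the squared distance by 2 (d j - d i) + 2 / (i+1) + 2 / (j+1), and d j <= s. *)
pose e i : R := 2 * (s - d i) + 4 * i.+1%:R^-1.
have e0 : e j @[j --> \oo] --> 0.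
  rewrite (_ : 0 = 2 * (s - s) + 4 * 0); last by rewrite subrr !mulr0 addr0.
  apply: cvgD; apply: cvgMr; last exact: cvg_harmonic.
  by apply: cvgB => //; exact: cvg_cst.
have ue i j : (i <= j)%N -> nrm2 (fun x => u i x - u j x) <= e i.
  move=> ij.
  have Kj := Kdd _ _ _ ij (hu j).1.
  have := dle _ _ (Kc _ _ _ (hu i).1 Kj).
  rewrite nrm2_mid // => h.
  have := (hu i).2; have := (hu j).2; have := ds j.
  have : j.+1%:R^-1 <= i.+1%:R^-1 :> R.
    by rewrite lef_pV2 ?posrE ?ltr0Sn // ler_nat.
  rewrite /e; move: h; set a : R := i.+1%:R^-1; set b : R := j.+1%:R^-1.
  by move: a b (d i) (d j) (nrm2 _) (nrm2 _) (nrm2 _) => a b di dj p q r; lra.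
have [f [hf h]] := L2_complete u2 ue e0.
exists u, f; split=> //; first by move=> j; exact: (hu j).1.
apply: (squeeze_cvgr _ (cvg_cst 0) e0).
by apply: nearW => j; rewrite nrm2_ge0 h.
Qed.

(** * Orthogonal projection onto a closed subspace *)

Section ClosedSubspace.
Variable S : set (T -> C).
Hypothesis hS : closed_subspace mu S.

Lemma subspace_L2 f : S f -> inL2 f.
Proof. by case: hS => h _ _ _ _; exact: h. Qed.
Lemma subspace0 : S (fun _ => 0).
Proof. by case: hS. Qed.
Lemma subspaceD f g : S f -> S g -> S (fun x => f x + g x).
Proof. by case: hS => _ _ h _ _; exact: h. Qed.
Lemma subspaceZ c f : S f -> S (fun x => c * f x).
Proof. by case: hS => _ _ _ h _; exact: h. Qed.
Lemma subspaceB f g : S f -> S g -> S (fun x => f x - g x).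
Proof.
move=> Sf Sg; have := subspaceD Sf (subspaceZ (-1) Sg).
by under eq_fun do rewrite mulN1r.
Qed.

Lemma subspace_closed (u : nat -> T -> C) f : (forall j, S (u j)) -> inL2 f ->
  nrm2 (fun x => u j x - f x) @[j --> \oo] --> 0 -> S f.
Proof.
case: hS => h2 _ _ _ h Su hf cv; apply: (h u) => //.
under eq_fun => j.
  by rewrite pnorm2E; last (apply: L2B => //; exact: h2); over.
by apply: cvg_EFin => //; exact: nearW.
Qed.

(** A constant sequence converges in L2 to every representative of its class, so closedness already
    contains stability under a.e. equality. *)
Lemma subspace_ae f g : cmeasurable g -> S f -> f =ae g -> S g.
Proof.
move=> mg Sf fg; have hg := L2_ae mg (subspace_L2 Sf) fg.
apply: (@subspace_closed (fun _ => f)) => //.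
rewrite (_ : nrm2 _ = 0); first exact: cvg_cst.
rewrite -(nrm2_0 mu); apply: nrm2_ae.
- by apply: cmeasurableB => //; exact/L2_meas/subspace_L2.
- exact: cmeasurable_cst.
- by apply: filterS fg => x ->; rewrite subrr.
Qed.

(** First variation: subtracting a small multiple of the component along [h] would lower the norm
    unless that component vanishes. *)
Lemma minimal_orthogonal w : inL2 w ->
  (forall h, S h -> nrm2 w <= nrm2 (fun x => w x - h x)) ->
  forall h, S h -> inner w h = 0.
Proof.
move=> hw wmin h Sh; have hh := subspace_L2 Sh.
set a := inner w h; set b := nrm2 h.
(* With b + 1 in place of b the case b = 0 needs no separate treatment; t b = 1 - t then reduces the
   inequality to t |a|^2 (1 + t) <= 0. *)
pose t : R := (b + 1)^-1.
have b0 : 0 <= b := nrm2_ge0 _ _.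
have := wmin _ (subspaceZ (t%:C * a) Sh).
rewrite nrm2B //; last exact: L2Z.
rewrite nrm2Z // inner_scaler // -/a -/b conjM conjCR -mulrA (mulrC a^*) mulcJ.
rewrite Normc.normcM normcR exprMn real_normK ?num_real // !cE /=.
rewrite !(mul0r, mulr0, subr0) => H.
apply: normc0_eq0; apply/eqP; rewrite -sqrf_eq0 eq_le sqr_ge0 andbT.
have tb : t * (b + 1) = 1 by rewrite mulVf //; lra.
have t0 : 0 < t by rewrite invr_gt0; lra.
set q := Normc.normc a ^+ 2 in H *.
have q0 : 0 <= q by exact: sqr_ge0.
have {H} : 2 * (t * q) <= t ^+ 2 * q * b by move: H; lra.
rewrite (_ : t ^+ 2 * q * b = t * q * (t * b)); last by ring.
have -> : t * b = 1 - t by move: tb; lra.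
move=> H; have : t * q * (1 + t) <= 0 by move: H; lra.
rewrite pmulr_lle0; last by lra.
by rewrite pmulr_rle0.
Qed.

(** The residual is the element of least norm in the coset f + S. It is a strong limit of
    near-minimal elements, remains in the coset because S is closed, and is orthogonal to S by
    minimality. *)
Lemma proj_exists f : inL2 f -> exists g, is_proj mu S f g.
Proof.
move=> hf.
pose D := [set w | inL2 w /\ S (fun x => f x - w x)].
have Df : D f by split=> //; under eq_fun do rewrite subrr; exact: subspace0.
pose d := inf [set nrm2 w | w in D].
have hinf : has_inf [set nrm2 w | w in D].
  split; first by exists (nrm2 f), f.
  by exists 0 => _ [w _ <-]; exact: nrm2_ge0.
have dle w : D w -> d <= nrm2 w.
  by move=> Dw; apply: ge_inf; [exact: hinf.2|exists w].
pose K j := [set w | D w /\ nrm2 w <= d + j.+1%:R^-1].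
have [|||||u [w [Ku hw uw]]] := @nested_convex K (d + 1).
- by move=> j w [[]].
- move=> j w [_ h]; apply: le_trans h _; rewrite lerD2l invf_le1 ?ltr0Sn //.
  by rewrite ler1n.
- move=> j; have [|_ [w Dw <-] h] := @inf_adherent _ _ j.+1%:R^-1 _ hinf.
    by rewrite invr_gt0 ltr0Sn.
  by exists w; split=> //; exact: ltW.
- move=> j w [Dw h]; split=> //; apply: le_trans h _.
  by rewrite lerD2l lef_pV2 ?posrE ?ltr0Sn // ler_nat.
- move=> j w w' [[hw Sw] h] [[hw' Sw'] h']; split; first split.
  + by apply: L2Z; exact: L2D.
  + have := subspaceZ (2^-1)%:C (subspaceD Sw Sw'); congr S; apply/funext => x.
    by apply: complexP; rewrite !cE /=; field.
  + rewrite nrm2_mid //; have := nrm2_ge0 mu (fun x => w x - w' x); move: h h'.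
    by move: (j.+1%:R^-1 : R) => a; lra.
have Dw : D w.
  split=> //; apply: (@subspace_closed (fun j x => f x - u j x)).
  - by move=> j; exact: (Ku j).1.2.
  - exact: L2B.
  - have E j : nrm2 (fun x => f x - u j x - (f x - w x)) = nrm2 (fun x => u j x - w x).
      rewrite [RHS]nrm2BC; congr sqnorm; apply/funext => x.
      by apply: complexP; rewrite !cE; ring.
    by under eq_fun do rewrite E.
have wmin : nrm2 w <= d.
  apply: (nrm2_lim_le _ hw uw (fun j => (Ku j).2)); first by move=> j; exact: (Ku j).1.1.
  by rewrite -[X in _ --> X]addr0; apply: cvgD; [exact: cvg_cst|exact: cvg_harmonic].
exists (fun x => f x - w x); split; first exact: Dw.2.
have -> : (fun x => f x - (f x - w x)) = w.
  by apply/funext => x; rewrite opprB addrC subrK.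
apply: minimal_orthogonal => // h Sh; apply: le_trans wmin _; apply: dle; split.
  by apply: L2B => //; exact: subspace_L2.
have := subspaceD Dw.2 Sh; congr S; apply/funext => x.
by rewrite opprB addrCA addrC.
Qed.

Lemma proj_contract f g : inL2 f -> is_proj mu S f g -> nrm2 g <= nrm2 f.
Proof.
move=> hf [Sg hg]; have Lg := subspace_L2 Sg.
have -> : nrm2 f = nrm2 (fun x => (f x - g x) + g x).
  by congr sqnorm; apply/funext => x; rewrite subrK.
rewrite nrm2D //; last exact: L2B.
by rewrite hg //= mulr0 addr0 lerDr nrm2_ge0.
Qed.

End ClosedSubspace.
End Hilbert.

(** * Orthonormality of the monomials *)

Section E2pi.
Variable R : realType.
Local Notation C := R[i].

Lemma e2piD (a b : R) : e2pi (a + b) = e2pi a * e2pi b.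
Proof.
by rewrite /e2pi mulrDr cosD sinD; apply: complexP; rewrite !cE /=; ring.
Qed.

Lemma e2pi0 : e2pi (0 : R) = 1.
Proof. by rewrite /e2pi mulr0 cos0 sin0. Qed.

Lemma e2piN (a : R) : e2pi (- a) = (e2pi a)^*.
Proof. by rewrite /e2pi mulrN cosN sinN. Qed.

Lemma normc_e2pi (a : R) : Normc.normc (e2pi a) = 1.
Proof. by rewrite /e2pi /= cos2Dsin2 sqrtr1. Qed.

Lemma e2pi_int (m : int) : e2pi (m%:~R : R) = 1.
Proof.
have e1 : e2pi (1 : R) = 1.
  by rewrite /e2pi mulr1 mulr_natl cos2pi sin2pi.
have en (l : nat) : e2pi (l%:R : R) = 1.
  by elim: l => [|l IH]; rewrite ?e2pi0 // -natr1 e2piD IH e1 mulr1.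
case: m => l; first exact: en.
have en' : e2pi (l.+1%:~R : R) = 1 := en l.+1.
by rewrite NegzE mulrNz e2piN en' conjC1.
Qed.

Lemma cos_int_shift (m : int) (c : R) : cos (2 * pi * m%:~R + c) = cos c.
Proof.
have -> : c = 2 * pi * (c / (2 * pi)) by rewrite mulrC divfK // mulf_neq0 // gt_eqF ?pi_gt0.
rewrite -mulrDr; have := e2piD m%:~R (c / (2 * pi)).
by rewrite e2pi_int mul1r => -[].
Qed.

Lemma sin_int_shift (m : int) (c : R) : sin (2 * pi * m%:~R + c) = sin c.
Proof.
have -> : c = 2 * pi * (c / (2 * pi)) by rewrite mulrC divfK // mulf_neq0 // gt_eqF ?pi_gt0.
rewrite -mulrDr; have := e2piD m%:~R (c / (2 * pi)).
by rewrite e2pi_int mul1r => -[].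
Qed.

(** The added 1 makes the integrand nonnegative, so that the result can be inserted in a Tonelli
    argument. In the primitive t + sin(a t + c) / a the sine takes equal values at 0 and 1. *)
Lemma integral_cos_period (m : int) (c : R) : m != 0 ->
  (\int[lebesgue_measure]_(t in `[0%R, 1%R]) (1 + cos (2 * pi * m%:~R * t + c))%:E = 1)%E.
Proof.
move=> m0; set a := 2 * pi * m%:~R.
have a0 : a != 0 by rewrite !mulf_neq0 // ?intr_eq0 // gt_eqF ?pi_gt0.
pose F : R -> R := id + a^-1 *: (sin \o (fun t => a * t + c)).
have dF (t : R) : is_derive t (1 : R) F (1 + cos (a * t + c)).
  have daff : is_derive t (1 : R) (fun t => a * t + c) a.
    have := is_deriveD (is_deriveZ a (is_derive_id t (1 : R))) (is_derive_cst c t 1).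
    by rewrite scaler1 addr0.
  have := is_deriveD (is_derive_id t (1 : R))
    (is_deriveZ a^-1 (@is_derive1_comp R sin (fun t => a * t + c) t _ _ (is_derive_sin _) daff)).
  congr is_derive; rewrite /= mulrC.
  by congr (_ + _); rewrite /GRing.scale /= mulKf.
have cF : continuous F.
  move=> t; apply: differentiable_continuous; apply/derivable1_diffP.
  by have := dF t => -[].
have E : {in `]0, 1[, F^`()%classic =1 (fun t => 1 + cos (a * t + c))}.
  by move=> t _; rewrite derive1E; exact: (@derive_val _ _ _ _ _ _ _ (dF t)).
rewrite (continuous_FTC2 ltr01 _ _ E).
- rewrite -EFinB; congr EFin; rewrite /F /= !fctE /= mulr1 mulr0 add0r sin_int_shift.
  by rewrite add0r addrK.
- apply: continuous_subspaceT => t; apply: cvgD; first exact: cvg_cst.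
  apply: (@continuous_comp _ _ _ (fun t => a * t + c) cos).
    by apply: cvgD; [apply: cvgMr; exact: cvg_id|exact: cvg_cst].
  exact: continuous_cos.
- split.
  + by move=> t _; have := dF t => -[].
  + by apply: cvg_at_right_filter; exact: cF.
  + by apply: cvg_at_left_filter; exact: cF.
Qed.

End E2pi.

(** * The torus measure and the resampling of one coordinate *)

Section TorusProbability.
Variables (R : realType) (n : nat) (mu : {measure set (torus R n) -> \bar R}).

(** An alias of [mu] that carries the proof of total mass 1, so that a probability structure can be
    attached to it and the product with the uniform law formed. *)
Definition torus_prob (_ : mu setT = 1%E) : set (torus R n) -> \bar R := mu.

Variable mu1 : mu setT = 1%E.
HB.instance Definition _ := Measure.copy (torus_prob mu1) mu.
HB.instance Definition _ :=
  @Measure_isProbability.Build _ _ _ (torus_prob mu1) mu1.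

End TorusProbability.

Section TorusMeasure.
Variables (R : realType) (n : nat) (mu : {measure set (torus R n) -> \bar R}).
Hypothesis hmu : is_torus_measure mu.
Local Notation C := R[i].
Local Notation T := (torus R n).
Local Notation "x %:C" := (real_complex R x) : ring_scope.
Implicit Types f g h : T -> C.

Lemma lebesgue_unit : lebesgue_measure (`[0%R, 1%R[%classic : set R) = 1%E.
Proof. by rewrite lebesgue_measure_itv /= lte_fin ltr01 sube0. Qed.

Lemma torus_measureT : mu setT = 1%E.
Proof.
have := hmu (fun _ => @measurableT _ R).
rewrite (_ : [set x | _] = setT); last by apply/seteqP; split.
by move->; apply: big1 => i _; rewrite setTI lebesgue_unit.
Qed.

Definition box (A : 'I_n -> set R) : set T := [set x | forall i, A i (x ord0 i)].

Lemma measurable_coord (i : 'I_n) : measurable_fun setT (fun x : T => x ord0 i).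
Proof.
move=> _ B mB; rewrite setTI; apply: sub_sigma_algebra.
by exists i, B.
Qed.

Lemma measurable_box A : (forall i, measurable (A i)) -> measurable (box A).
Proof.
move=> mA.
have -> : box A = \bigcap_(i in [set: 'I_n]) ((fun x : T => x ord0 i) @^-1` (A i)).
  by apply/seteqP; split => x h i; [move=> _|]; apply: h.
apply: fin_bigcap_measurable => // i _.
by rewrite -[X in measurable X]setTI; exact: measurable_coord.
Qed.

Definition boxes : set (set T) :=
  [set B | exists A, (forall i, measurable (A i)) /\ B = box A].

Lemma measurable_boxesE : @measurable _ T = <<s boxes >>.
Proof.
apply/seteqP; split.
  apply: smallest_sub; first exact: smallest_sigma_algebra.
  move=> _ [i [B [mB ->]]]; apply: sub_sigma_algebra.
  exists (fun j => if j == i then B else setT); split.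
    by move=> j; case: ifP.
  apply/seteqP; split => x /=; first by move=> Bx j; case: eqP => // ->.
  by move=> /(_ i); rewrite eqxx.
apply: smallest_sub; first exact: sigma_algebra_measurable.
by move=> _ [A [mA ->]]; exact: measurable_box.
Qed.

Lemma boxes_setI : setI_closed boxes.
Proof.
move=> _ _ [A [mA ->]] [B [mB ->]]; exists (fun i => A i `&` B i); split.
  by move=> i; exact: measurableI.
apply/seteqP; split => x; first by move=> [hA hB] i; split.
by move=> h; split=> i; case: (h i).
Qed.

Lemma torus_measure_unique (nu : {measure set T -> \bar R}) :
  (forall A, (forall i, measurable (A i)) -> nu (box A) = mu (box A)) ->
  forall B, measurable B -> nu B = mu B.
Proof.
move=> h B mB; apply: (measure_unique boxes (fun _ => setT)) => //.
- exact: measurable_boxesE.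
- exact: boxes_setI.
- by move=> _; exists (fun _ => setT); split=> //; apply/seteqP; split.
- by rewrite bigcup_const //; exists 0%N.
- by move=> _ [A [mA ->]]; exact: h.
- move=> _; have -> : setT = box (fun _ => setT) by apply/seteqP; split.
  rewrite h // (_ : box _ = setT); last by apply/seteqP; split.
  by rewrite torus_measureT ltry.
Qed.

Section ReplaceCoordinate.
Variable i : 'I_n.

Definition replace_coord (p : R * T) : T :=
  \row_j (if j == i then p.1 else p.2 ord0 j).

Lemma measurable_replace : measurable_fun setT replace_coord.
Proof.
apply: (@measurability _ _ _ _ setT replace_coord (@coord_sets R n)) => //.
move=> _ [_ [j [B [mB ->]]] <-]; rewrite setTI.
have [->|ji] := eqVneq j i.
  have -> : replace_coord @^-1` ((fun x : T => x ord0 i) @^-1` B) = fst @^-1` B.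
    by apply/seteqP; split => p /=; rewrite mxE eqxx.
  by rewrite -[X in measurable X]setTI; exact: measurable_fst.
have -> : replace_coord @^-1` ((fun x : T => x ord0 j) @^-1` B) =
    snd @^-1` ((fun x : T => x ord0 j) @^-1` B).
  by apply/seteqP; split => p /=; rewrite mxE (negbTE ji).
rewrite -[X in measurable X]setTI; apply: measurable_snd => //.
by rewrite -[X in measurable X]setTI; exact: measurable_coord.
Qed.

(** The uniform law lives on the closed interval and the torus measure on the half-open one; they
    differ by the null point 1. *)
Lemma uniform01E (A : set R) : measurable A ->
  uniform_prob (@ltr01 R) A = lebesgue_measure (A `&` `[0%R, 1%R[).
Proof.
move=> mA; rewrite /uniform_prob integral_uniform_pdf.
rewrite (eq_integral (fun _ => 1%:E)); last first.
  move=> x /set_mem [_ /=]; rewrite in_itv /= /uniform_pdf => ->.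
  by rewrite subr0 invr1.
rewrite integral_cst ?mul1e; last exact: measurableI.
have -> : A `&` `[0, 1] = (A `&` `[0%R, 1%R[) `|` (A `&` [set 1]).
  rewrite -setIUr; congr (_ `&` _).
  apply/seteqP; split => x /=; rewrite !in_itv /=.
    by case/andP=> x0; rewrite le_eqVlt => /orP[/eqP ->|x1]; [right|left; rewrite x0].
  by case=> [/andP[-> /ltW ->]//|->]; rewrite ler01 lexx.
apply/eqP; rewrite eq_le; apply/andP; split.
  apply: le_trans (measureU2 _ _ _) _; try exact: measurableI.
  rewrite [X in (_ + X)%E](_ : _ = 0%E) ?adde0 //.
  apply/eqP; rewrite -measure_le0 -(lebesgue_measure_set1 (1 : R)).
  by apply: le_measure; rewrite ?inE //; exact: measurableI.
by apply: le_measure; rewrite ?inE; [exact: measurableI|apply: measurableU; exact: measurableI|left].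
Qed.

(* Resampling one coordinate uniformly leaves [mu] invariant, as is seen on boxes. *)
Lemma ge0_integral_replace (f : T -> \bar R) : measurable_fun setT f ->
  (forall x, (0 <= f x)%E) ->
  (\int[mu]_x f x =
   \int[mu]_x \int[lebesgue_measure]_(t in `[0%R, 1%R]) f (replace_coord (t, x)))%E.
Proof.
move=> mf f0.
pose P : probability T R := torus_prob torus_measureT.
pose U := uniform_prob (@ltr01 R).
pose nu := pushforward (U \x P)%E replace_coord.
have nuE B : measurable B -> nu B = mu B.
  apply: (@torus_measure_unique nu); first exact: measurable_replace.
  move=> ? A mA.
  change ((U \x P)%E (replace_coord @^-1` box A) = mu (box A)).
  (* The preimage of a box is a rectangle: side [i] constrains the fresh coordinate only, and the
     old coordinate [i] becomes free, contributing a factor 1. *)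
  have -> : replace_coord @^-1` box A =
      A i `*` box (fun j => if j == i then setT else A j).
    apply/seteqP; split => -[t x] /=.
      move=> h; split; first by have := h i; rewrite mxE eqxx.
      by move=> j; case: ifP => // ji; have := h j; rewrite mxE ji.
    by move=> [h1 h2] j; rewrite mxE; case: eqP => [->//|/eqP ji]; have := h2 j; rewrite (negbTE ji).
  have mA' j : measurable (if j == i then setT else A j) by case: ifP.
  rewrite product_measure1E; [|exact: (mA i)|exact: measurable_box].
  rewrite /= (uniform01E (mA i)) /P /= (hmu mA') (hmu mA) (bigD1 i) //= eqxx setTI lebesgue_unit mul1e.
  rewrite [RHS](bigD1 i) //=; congr (_ * _)%E.
  by apply: eq_bigr => j /negbTE ->.
have mr := measurable_replace.
transitivity (\int[nu]_x f x)%E.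
  by apply: eq_measure_integral => A mA _; exact/esym/nuE.
rewrite ge0_integral_pushforward //= preimage_setT.
have mc : measurable_fun setT (f \o replace_coord) by apply: measurableT_comp mf mr.
rewrite (@fubini_tonelli2 _ _ _ _ _ U P (f \o replace_coord) mc); last by move=> p; exact: f0.
apply: eq_integral => x _; rewrite /fubini_G integral_uniform //=.
  by rewrite subr0 invr1 mul1e.
by apply: (measurableT_comp mc); exact: pair2_measurable.
Qed.

End ReplaceCoordinate.

(** * Integrals and inner products of monomials *)

Lemma measurable_linear (k : 'I_n -> int) :
  measurable_fun setT (fun x : T => \sum_(i < n) (k i)%:~R * x ord0 i).
Proof.
apply: measurable_sum => i; apply: measurable_funM => //.
exact: measurable_coord.
Qed.

(** After resampling coordinate [i], the inner integral runs over a whole nonzero number of periods;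
    the other coordinates only shift the phase. *)
Lemma integral_cos_linear (k : 'I_n -> int) (c : R) (i : 'I_n) : k i != 0 ->
  Rintegral mu setT (fun x : T => cos (2 * pi * (\sum_(i < n) (k i)%:~R * x ord0 i) + c)) = 0.
Proof.
move=> ki; set g := fun x : T => _.
have mg : measurable_fun setT g.
  apply: measurableT_comp; first by apply: continuous_measurable_fun; exact: continuous_cos.
  by apply: measurable_funD => //; apply: measurable_funM => //; exact: measurable_linear.
have gr : rint mu g.
  apply: (rint_le mg (rint_cst torus_measureT 1)) => x.
  by rewrite ler_norml cos_geN1 cos_le1.
have E : (\int[mu]_x (1 + g x)%:E = 1)%E.
  rewrite (ge0_integral_replace i).
  - rewrite -torus_measureT -[RHS]mul1e -integral_cst //; apply: eq_integral => x _.
    rewrite -(integral_cos_period (2 * pi * (\sum_(j < n | j != i) (k j)%:~R * x ord0 j) + c) ki).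
    apply: eq_integral => t _; rewrite /g (bigD1 i) //= mxE eqxx; congr (1 + cos _)%:E.
    rewrite mulrDr !mulrA -!addrA; congr (_ + (_ * _ + _)).
    by apply: eq_bigr => j ji; rewrite mxE (negbTE ji).
  - by apply/measurable_EFinP; apply: measurable_funD.
  - by move=> x; rewrite lee_fin /g; have := cos_geN1 (2 * pi * (\sum_(i < n) (k i)%:~R * x ord0 i) + c); lra.
have : Rintegral mu setT (fun x => 1 + g x) = 1 by rewrite /Rintegral E.
rewrite RintegralD //; last exact: (rint_cst torus_measureT 1).
by rewrite Rintegral_cst // torus_measureT /= mulr1; lra.
Qed.

Lemma cmeasurable_monomial k : cmeasurable (monomial k : T -> C).
Proof.
have m := measurable_linear k.
split; (apply: measurableT_comp;
  [by apply: continuous_measurable_fun; first [exact: continuous_cos|exact: continuous_sin]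
  |by apply: measurable_funM]).
Qed.

Lemma normc_monomial k (x : T) : Normc.normc (monomial k x) = 1.
Proof. exact: normc_e2pi. Qed.

Lemma monomialM k l (x : T) :
  monomial (fun i => k i + l i) x = monomial k x * monomial l x :> C.
Proof.
rewrite /monomial -e2piD -big_split; congr e2pi; apply: eq_bigr => i _.
by rewrite intrD mulrDl.
Qed.

Lemma monomialJ k (x : T) : (monomial k x)^* = monomial (fun i => - k i) x :> C.
Proof.
rewrite /monomial -e2piN -sumrN; congr e2pi; apply: eq_bigr => i _.
by rewrite intrN mulNr.
Qed.

Lemma monomial0 (x : T) : monomial (fun _ => 0) x = 1 :> C.
Proof.
by rewrite /monomial big1 ?e2pi0 // => i _; rewrite mul0r.
Qed.

Lemma zcoordE i (x : T) :
  zcoord i x = monomial (fun j => (j == i)%:R) x :> C.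
Proof.
rewrite /zcoord /monomial (bigD1 i) //= eqxx mul1r big1 ?addr0 //.
by move=> j /negbTE ->; rewrite mul0r.
Qed.

Lemma L2_monomial k : inL2 mu (monomial k).
Proof.
apply: (L2_bounded torus_measureT (cmeasurable_monomial k) (M := 1)) => x.
by rewrite normc_monomial.
Qed.

Lemma cint_monomial k :
  cint mu (monomial k) = (if k == (fun _ => 0) then 1 else 0).
Proof.
case: eqP => [->|k0].
  have -> : monomial (fun _ => 0) = (fun _ => 1%:C) :> (T -> C).
    by apply/funext => x; exact: monomial0.
  by rewrite (cint_real mu (fun _ => 1)) Rintegral_cst // torus_measureT /= mulr1.
have [i ki] : exists i, k i != 0.
  apply: contrapT => h; apply: k0; apply/funext => i; apply/eqP.
  by apply: contrapT => /negP ki; apply: h; exists i.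
apply: complexP => /=.
  rewrite -[RHS](integral_cos_linear 0 ki).
  by apply: eq_Rintegral => x _; rewrite addr0.
(* The sine is the cosine with phase -pi/2. *)
rewrite -[RHS](integral_cos_linear (- (pi / 2)) ki).
apply: eq_Rintegral => x _.
by rewrite cosD cosN cos_pihalf sinN sin_pihalf; ring.
Qed.

Lemma inner_monomial k l :
  inner mu (monomial k) (monomial l) = (if k == l then 1 else 0).
Proof.
rewrite /inner (_ : (fun x => _) = monomial (fun i => k i - l i)); last first.
  by apply/funext => x; rewrite monomialJ -monomialM.
rewrite cint_monomial; congr (if _ then _ else _).
apply/eqP/eqP => [h|->]; apply/funext => i; last by rewrite subrr.
by have := congr1 (@^~ i) h => /eqP; rewrite subr_eq0 => /eqP.
Qed.

End TorusMeasure.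

(** * Completeness of the monomials *)

Section SignIterates.
Variable R : realType.
Implicit Types u v : R.

(* A polynomial self-map of [-1, 1] whose iterates converge to the sign. *)
Definition sign_step u : R := (3 * u - u ^+ 3) / 2.

(** The fixed points 1 and -1 are critical points of the cubic, hence the squared factors in both
    differences. *)
Lemma sign_step_bound u : `|u| <= 1 -> `|sign_step u| <= 1.
Proof.
rewrite !ler_norml /sign_step => /andP[h1 h2]; apply/andP; split.
  rewrite -subr_ge0.
  have -> : (3 * u - u ^+ 3) / 2 - -1 = (1 + u) ^+ 2 * (2 - u) / 2 by field.
  by rewrite divr_ge0 // mulr_ge0 ?sqr_ge0 //; lra.
rewrite -subr_ge0.
have -> : 1 - (3 * u - u ^+ 3) / 2 = (1 - u) ^+ 2 * (2 + u) / 2 by field.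
by rewrite divr_ge0 // mulr_ge0 ?sqr_ge0 //; lra.
Qed.

Lemma iter_sign_bound N u : `|u| <= 1 -> `|iter N sign_step u| <= 1.
Proof. by move=> h; elim: N => //= N; exact: sign_step_bound. Qed.

Lemma iter_signN N u : iter N sign_step (- u) = - iter N sign_step u.
Proof. by elim: N => //= N ->; rewrite /sign_step; field. Qed.

(** The iterates increase from [u], and as long as v >= u one step multiplies the distance to 1 by
    at most 1 - u / 2. *)
Lemma iter_sign_pos N u : 0 < u <= 1 ->
  u <= iter N sign_step u <= 1 /\ 1 - iter N sign_step u <= (1 - u / 2) ^+ N.
Proof.
move=> /andP[u0 u1]; elim: N => [|N [/andP[h1 h2] h3]] /=.
  by rewrite lexx u1 expr0; split=> //; lra.
set v := iter N sign_step u in h1 h2 h3 *.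
have step1 : 1 - sign_step v <= (1 - v) * (1 - u / 2).
  rewrite -subr_ge0 /sign_step.
  have -> : (1 - v) * (1 - u / 2) - (1 - (3 * v - v ^+ 3) / 2) =
     (1 - v) * ((v - u) + v ^+ 2) / 2 by field.
  have v1 : 0 <= 1 - v by lra.
  have v2 : 0 <= v - u + v ^+ 2 by rewrite addr_ge0 ?sqr_ge0 // subr_ge0.
  by rewrite divr_ge0 // mulr_ge0.
have step2 : v <= sign_step v.
  rewrite -subr_ge0 /sign_step.
  have -> : (3 * v - v ^+ 3) / 2 - v = v * (1 + v) * (1 - v) / 2 by field.
  by rewrite divr_ge0 // !mulr_ge0 //; lra.
split.
  rewrite (le_trans h1 step2) /=.
  by have := @sign_step_bound v; rewrite !ler_norml => /(_ _)/andP[]//; lra.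
apply: le_trans step1 _; rewrite exprSr ler_wpM2r //; lra.
Qed.

Lemma iter_sign_cvg_pos u : 0 < u <= 1 ->
  iter N sign_step u @[N --> \oo] --> (1 : R).
Proof.
move=> u01; have /andP[u0 u1] := u01.
have c : 1 - (1 - u / 2) ^+ N @[N --> \oo] --> (1 - 0 : R).
  by apply: cvgB; [exact: cvg_cst|apply: cvg_expr; rewrite ger0_norm; lra].
rewrite -[X in _ --> X]subr0; apply: (squeeze_cvgr _ c (cvg_cst _)).
apply: nearW => N; have [/andP[_ h1] h2] := iter_sign_pos N u01.
by rewrite subr0 h1 andbT; lra.
Qed.

Lemma iter_sign_cvg_neg u : -1 <= u < 0 ->
  iter N sign_step u @[N --> \oo] --> (-1 : R).
Proof.
move=> /andP[h1 h2]; have := @iter_sign_cvg_pos (- u).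
move=> /(_ _) /cvgN; rewrite -[in X in _ -> X](opprK u) => h.
under eq_fun do rewrite iter_signN.
by apply: h; apply/andP; split; lra.
Qed.

End SignIterates.

(** * Trigonometric polynomials *)

Section TrigPoly.
Variables (R : realType) (n : nat).
Local Notation C := R[i].
Local Notation T := (torus R n).
Local Notation "x %:C" := (real_complex R x) : ring_scope.

(** The linear span of the monomials, given inductively so that linear properties are proved by
    induction on the way a polynomial is built. *)
Inductive trigpoly : (T -> C) -> Prop :=
| trig_monomial k : trigpoly (monomial k)
| trigD p q : trigpoly p -> trigpoly q -> trigpoly (fun x => p x + q x)
| trigZ c p : trigpoly p -> trigpoly (fun x => c * p x).

Lemma trig_cst c : trigpoly (fun _ => c).
Proof.
have := trigZ c (trig_monomial (fun _ => 0)).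
by under eq_fun do rewrite monomial0 mulr1.
Qed.

Lemma trigM p q : trigpoly p -> trigpoly q -> trigpoly (fun x => p x * q x).
Proof.
move=> hp hq; elim: hp => [k|p1 p2 _ h1 _ h2|c p' _ h].
- elim: hq => [l|p1 p2 _ h1 _ h2|c p' _ h].
  + have := trig_monomial (fun i => k i + l i).
    by congr trigpoly; apply/funext => x; rewrite monomialM.
  + by have := trigD h1 h2; under eq_fun do rewrite -mulrDr.
  + by have := trigZ c h; under eq_fun do rewrite mulrCA.
- by have := trigD h1 h2; under eq_fun do rewrite -mulrDl.
- by have := trigZ c h; under eq_fun do rewrite mulrA.
Qed.

Lemma trig_meas p : trigpoly p -> cmeasurable p.
Proof.
elim=> [k|p1 p2 _ h1 _ h2|c p' _ h].
- exact: cmeasurable_monomial.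
- exact: cmeasurableD.
- by apply: cmeasurableM => //; exact: cmeasurable_cst.
Qed.

Definition rtrig (s : T -> R) := trigpoly (fun x => (s x)%:C).

Lemma rtrigD s t : rtrig s -> rtrig t -> rtrig (fun x => s x + t x).
Proof. by move=> hs ht; have := trigD hs ht; under eq_fun do rewrite -rmorphD. Qed.

Lemma rtrigM s t : rtrig s -> rtrig t -> rtrig (fun x => s x * t x).
Proof. by move=> hs ht; have := trigM hs ht; under eq_fun do rewrite -rmorphM. Qed.

Lemma rtrig_cst (c : R) : rtrig (fun _ => c).
Proof. exact: trig_cst. Qed.

Lemma rtrig_iter_sign N s : rtrig s -> rtrig (fun x => iter N (@sign_step R) (s x)).
Proof.
move=> hs; elim: N => //= N h.
have := rtrigD (rtrigM (rtrig_cst (3 / 2)) h)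
  (rtrigM (rtrig_cst (- (1 / 2))) (rtrigM h (rtrigM h h))).
congr rtrig; apply/funext => x; rewrite /sign_step.
by field.
Qed.

Lemma rtrig_cos i (b : R) : rtrig (fun x : T => cos (2 * pi * x ord0 i - pi * b)).
Proof.
(* The rotation by -pi b makes the average of [w z_i] and its conjugate equal to the shifted
   cosine. *)
pose w : C := e2pi (- (b / 2)).
pose e : 'I_n -> int := fun j => (j == i)%:R.
have := trigZ (2^-1)%:C (trigD (trigZ w (trig_monomial e))
   (trigZ w^* (trig_monomial (fun j => - e j)))).
congr trigpoly; apply/funext => x.
rewrite -monomialJ -conjM /e -zcoordE /zcoord /w -e2piD /e2pi.
have -> : 2 * pi * (- (b / 2) + x ord0 i) = 2 * pi * x ord0 i - pi * b by field.
by apply: complexP; rewrite !cE /=; field.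
Qed.

End TrigPoly.

(** * Density of trigonometric polynomials in L2 *)

Section Completeness.
Variables (R : realType) (n : nat) (mu : {measure set (torus R n) -> \bar R}).
Hypothesis hmu : is_torus_measure mu.
Local Notation C := R[i].
Local Notation T := (torus R n).
Local Notation "x %:C" := (real_complex R x) : ring_scope.
Local Notation inL2 := (inL2 mu).
Local Notation inner := (inner mu).
Local Notation nrm2 := (sqnorm mu).
Local Notation nrm := (L2norm mu).
Local Notation "f =ae g" := (Defs.ae_eq mu f g) (at level 70).
Implicit Types f g h : T -> C.
Let mu1 := torus_measureT hmu.

Lemma ae_coord (i : 'I_n) (B : set R) : measurable B ->
  lebesgue_measure (~` B `&` `[0%R, 1%R[) = 0%E ->
  {ae mu, forall x : T, B (x ord0 i)}.
Proof.
move=> mB B0; pose A j := if j == i then ~` B else setT.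
have mA j : measurable (A j) by rewrite /A; case: ifP => // _; exact: measurableC.
exists (box A); split; first exact: measurable_box.
  by rewrite (hmu mA) (bigD1 i) //= /A eqxx [X in (X * _)%E]B0 mul0e.
by move=> x /= Bx j; rewrite /A; case: eqP => // ->.
Qed.

(** The points 0 and [b] are the ends of the arc, where the cosine comparison becomes an equality;
    coordinates outside [0, 1[ carry no mass. *)
Lemma ae_coord_generic (i : 'I_n) (b : R) :
  {ae mu, forall x : T, 0 < x ord0 i < 1 /\ x ord0 i != b}.
Proof.
have mB : measurable (`]0%R, 1%R[%classic `\` [set b] : set R).
  by apply: measurableD.
apply: filterS (ae_coord i mB _).
  by move=> x /= []; rewrite in_itv /= => -> /eqP ->.
have m2 : measurable ([set 0%R] `|` [set b] : set R) by exact: measurableU.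
apply/eqP; rewrite -measure_le0.
apply: (@le_trans _ _ (lebesgue_measure ([set 0%R] `|` [set b] : set R))).
  apply: le_measure; rewrite ?inE //.
    by apply: measurableI => //; exact: measurableC.
  move=> x [/= h]; rewrite !in_itv /= => /andP[x0 x1].
  have [->|xb] := eqVneq x b; first by right.
  left; apply/eqP; rewrite eq_le x0 andbT leNgt; apply/negP => x0'.
  by apply: h; split; [rewrite in_itv /= x0'|exact/eqP].
apply: le_trans (measureU2 _ _ _) _ => //.
have e0 : lebesgue_measure [set 0%R : R] = 0%E by exact: lebesgue_measure_set1.
have eb : lebesgue_measure [set b] = 0%E by exact: lebesgue_measure_set1.
by rewrite [X in (X + _)%E]e0 [X in (_ + X)%E]eb adde0.
Qed.

(** The uniform bound serves dominated convergence and also makes the notion stable under products,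
    hence under intersections. *)
Definition trig_approx (A : set T) := exists s : nat -> T -> R,
  [/\ forall N, rtrig (s N), forall N x, `|s N x| <= 1 &
      {ae mu, forall x, s N x @[N --> \oo] --> (\1_A x : R)}].

Lemma trig_approxI A B : trig_approx A -> trig_approx B -> trig_approx (A `&` B).
Proof.
move=> [s [s1 s2 s3]] [t [t1 t2 t3]]; exists (fun N x => s N x * t N x); split.
- by move=> N; exact: rtrigM.
- by move=> N x; rewrite normrM mulr_ile1.
- apply: filterS2 s3 t3 => x hs ht; rewrite indicI /=.
  exact: cvgM hs ht.
Qed.

(** The angle 2 pi t - pi b vanishes at the midpoint b / 2 of the arc, so t < b means that its
    modulus is below pi b; the cosine is even and decreasing on [0, pi]. *)
Lemma cos_arc (b t : R) : 0 < b < 1 -> 0 < t < 1 ->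
  (t < b -> cos (pi * b) < cos (2 * pi * t - pi * b)) /\
  (b < t -> cos (2 * pi * t - pi * b) < cos (pi * b)).
Proof.
move=> /andP[b0 b1] /andP[t0 t1]; have p0 := pi_gt0 R.
have pb : pi * b \in `[0, pi] by rewrite in_itv /=; apply/andP; split; nra.
split=> tb.
  have [h|h] := lerP 0 (2 * pi * t - pi * b).
    by rewrite ltr_cos // ?in_itv /=; [nra|apply/andP; split; nra].
  rewrite -[X in _ < cos X]opprK cosN ltr_cos // ?in_itv /=; first nra.
  by apply/andP; split; nra.
(* An angle beyond pi is reflected to 2 pi minus itself, which is still larger than pi b. *)
have [h|h] := lerP (2 * pi * t - pi * b) pi.
  by rewrite ltr_cos // ?in_itv /=; [nra|apply/andP; split; nra].
have -> : cos (2 * pi * t - pi * b) = cos (2 * pi - (2 * pi * t - pi * b)).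
  by rewrite -[in LHS]cosN -(cos_int_shift 1) mulr1.
rewrite ltr_cos // ?in_itv /=; first nra.
by apply/andP; split; nra.
Qed.

(* On the circle, [0, b[ is the arc [cos (2 pi t - pi b) > cos (pi b)], and the
   sign iterates turn this inequality into its indicator. *)
Lemma trig_approx_ray (i : 'I_n) (b : R) :
  trig_approx [set x : T | x ord0 i < b].
Proof.
(* For b <= 0 the ray is null and for b >= 1 it has full measure, so constants suffice there. *)
have [b0|b0] := leP b 0.
  exists (fun _ _ => 0); split; [by move=> _; exact: rtrig_cst|by move=> _ x; rewrite normr0|].
  apply: filterS (ae_coord_generic i b) => x [/andP[x0 x1] _].
  rewrite indicE memNset; first exact: cvg_cst.
  by move=> /= xb; move: (lt_le_trans xb b0); rewrite ltNge ltW.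
have [b1|b1] := leP 1 b.
  exists (fun _ _ => 1); split; [by move=> _; exact: rtrig_cst|by move=> _ x; rewrite normr1|].
  apply: filterS (ae_coord_generic i b) => x [/andP[x0 x1] _].
  rewrite indicE mem_set; first exact: cvg_cst.
  exact: lt_le_trans x1 b1.
(* Half the difference of two cosines stays in [-1, 1], the domain of the sign iterates. *)
pose u (x : T) := (cos (2 * pi * x ord0 i - pi * b) - cos (pi * b)) / 2.
have u1 x : `|u x| <= 1.
  rewrite /u ler_norml.
  have := cos_geN1 (2 * pi * x ord0 i - pi * b); have := cos_le1 (2 * pi * x ord0 i - pi * b).
  by have := cos_geN1 (pi * b); have := cos_le1 (pi * b); lra.
have ut : rtrig u.
  have := rtrigM (rtrig_cst n (1 / 2)) (rtrigD (rtrig_cos i b) (rtrig_cst n (- cos (pi * b)))).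
  by congr rtrig; apply/funext => x; rewrite /u; field.
exists (fun N x => (1 + iter N (@sign_step R) (u x)) / 2); split.
- move=> N; have := rtrigM (rtrig_cst n (1 / 2)) (rtrigD (rtrig_cst n 1) (rtrig_iter_sign N ut)).
  by congr rtrig; apply/funext => x; field.
- move=> N x; have := iter_sign_bound N (u1 x); rewrite !ler_norml; lra.
- apply: filterS (ae_coord_generic i b) => x [x01 xb].
  have b01 : 0 < b < 1 by rewrite b0.
  have [lt1 lt2] := cos_arc b01 x01.
  have ub := u1 x; rewrite ler_norml in ub.
  have [xlt|xgt] := ltP (x ord0 i) b.
    rewrite indicE mem_set //=.
    have h : iter N (@sign_step R) (u x) @[N --> \oo] --> (1 : R).
      by apply: iter_sign_cvg_pos; have := lt1 xlt; move: ub; rewrite /u; lra.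
    rewrite (_ : 1%:R = (1 + 1) / 2 :> R); last by field.
    by apply: cvgMl; apply: cvgD => //; exact: cvg_cst.
  rewrite indicE memNset /=; last by apply/negP; rewrite -leNgt.
  have h : iter N (@sign_step R) (u x) @[N --> \oo] --> (-1 : R).
    apply: iter_sign_cvg_neg.
    have : b < x ord0 i by rewrite lt_neqAle eq_sym xb.
    by move/lt2; move: ub; rewrite /u; lra.
  rewrite (_ : 0%:R = (1 + -1) / 2 :> R); last by field.
  by apply: cvgMl; apply: cvgD => //; exact: cvg_cst.
Qed.

Definition approx_sets : set (set T) := [set A | measurable A /\ trig_approx A].

(** The rays { x_i < b } are approximable and generate the Borel sets of each coordinate. With
    stability under intersections this provides a generating pi-system. *)
Lemma measurable_approxE : @measurable _ T = <<s approx_sets >>.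
Proof.
apply/seteqP; split; last first.
  apply: smallest_sub; first exact: sigma_algebra_measurable.
  by move=> A [].
apply: smallest_sub; first exact: smallest_sigma_algebra.
move=> _ [i [B [mB ->]]].
(* The same space with the sigma-algebra generated by the approximable sets: it suffices that the
   coordinates be measurable for it. *)
pose T' := g_sigma_algebraType approx_sets.
have mc : measurable_fun setT (fun x : T' => (x : 'rV[R]_n) ord0 i).
  apply: (measurability _ (RGenInftyO.measurableE R)) => //.
  move=> _ [_ [b ->] <-]; rewrite setTI; apply: sub_sigma_algebra.
  have -> : (fun x : T' => (x : 'rV[R]_n) ord0 i) @^-1` `]-oo, b[ =
     [set x : T | x ord0 i < b].
    by apply/seteqP; split => x /=; rewrite in_itv.
  split; last exact: trig_approx_ray.
  have -> : [set x : T | x ord0 i < b] = (fun x : T => x ord0 i) @^-1` `]-oo, b[.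
    by apply/seteqP; split => x /=; rewrite in_itv.
  by rewrite -[X in measurable X]setTI; exact: measurable_coord.
by have := mc measurableT B mB; rewrite setTI.
Qed.

(** Dominated convergence with majorant |f| replaces the approximating polynomials by the
    indicator. *)
Lemma integral_trig_approx (f : T -> R) A : rint mu f -> measurable A -> trig_approx A ->
  (forall s, rtrig s -> (forall x, `|s x| <= 1) -> Rintegral mu setT (fun x => f x * s x) = 0) ->
  (\int[mu]_(x in A) (f x)%:E = 0)%E.
Proof.
move=> rf mA [s [s1 s2 s3]] h.
have ms N : measurable_fun setT (s N) := (trig_meas (s1 N)).1.
have mf := rint_meas rf.
have rfs N : rint mu (fun x => f x * s N x).
  apply: (rint_le _ (integrable_norm rf)); first exact: measurable_funM.
  by move=> x; rewrite normrM ler_piMr.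
have [] := @dominated_convergence _ _ _ mu setT measurableT (fun N x => (f x * s N x)%:E)
  (fun x => (f x * \1_A x)%:E) (fun x => `|f x|%:E).
- by move=> N; exact: measurable_int (rfs N).
- by apply/measurable_EFinP; apply: measurable_funM => //; exact: measurable_indic.
- apply: filterS s3 => x hx _; apply: cvg_EFin; first exact: nearW.
  by apply: cvgMr.
- exact: integrable_norm.
- by apply: nearW => x N _; rewrite lee_fin normrM ler_piMr.
move=> _ _ cv.
have E : (fun N => \int[mu]_x (f x * s N x)%:E)%E = (fun _ => 0%E).
  apply/funext => N; rewrite -[LHS]fineK; last exact: (integrable_fin_num measurableT (rfs N)).
  by congr EFin; exact: h.
have : (\int[mu]_x (f x * \1_A x)%:E = 0)%E.
  apply: (@cvg_unique _ (@ereal_hausdorff R) _ _ _ _ cv).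
  by rewrite /= E; exact: cvg_cst.
move=> <-; rewrite integral_mkcond; apply: eq_integral => x _.
by rewrite patchE indicE; case: ifP; rewrite ?mulr1 ?mulr0.
Qed.

(** The sets on which [f] integrates to 0 form a Dynkin class containing the approximable pi-system;
    testing with the constant 1 gives the whole space, and thereby complements. *)
Lemma trig_orthogonal_ae0 (f : T -> R) : rint mu f ->
  (forall s, rtrig s -> (forall x, `|s x| <= 1) -> Rintegral mu setT (fun x => f x * s x) = 0) ->
  {ae mu, forall x, f x = 0}.
Proof.
move=> rf h.
have h0 A : measurable A -> (\int[mu]_(x in A) (f x)%:E = 0)%E.
  rewrite measurable_approxE => mA.
  have fT : (\int[mu]_x (f x)%:E = 0)%E.
    rewrite -[LHS]fineK; last exact: integrable_fin_num.
    have := h _ (rtrig_cst n 1) _; rewrite normr1 => /(_ (fun=> lexx 1)).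
    by rewrite /Rintegral; under eq_integral do rewrite mulr1; move=> ->.
  apply: (@dynkin_induction _ _ approx_sets (fun A => \int[mu]_(x in A) (f x)%:E = 0)%E) => //.
  - exact: measurable_approxE.
  - move=> B B' [mB aB] [mB' aB']; split; [exact: measurableI|exact: trig_approxI].
  - by move=> B [mB aB]; exact: integral_trig_approx.
  - move=> B mB B0.
    have : (\int[mu]_(x in B `|` ~` B) (f x)%:E = 0)%E by rewrite setUv.
    have dB : [disjoint B & ~` B] by rewrite disj_set2E setICr.
    have mf : measurable_fun (B `|` ~` B) f by rewrite setUv; exact: rint_meas rf.
    by rewrite (integral_setU_EFin mu mB (measurableC mB) mf dB) B0 add0e.
  - move=> F mF tF F0; rewrite integral_bigcup //.
      by rewrite eseries0 // => i _ _; exact: F0.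
    by apply: integrableS rf => //; exact: bigcup_measurable.
have : ae_eq mu setT (fun x => (f x)%:E) (cst 0%E).
  apply: integral_ae_eq => // E _ mE; rewrite h0 // integral0 //.
by apply: filterS => x /(_ I) [].
Qed.

Lemma trig_L2 p : trigpoly p -> inL2 p.
Proof.
elim=> [k|p1 p2 _ h1 _ h2|c p' _ h]; first exact: L2_monomial.
  exact: L2D.
exact: L2Z.
Qed.

Lemma fourier_complete f : inL2 f -> (forall k, fourier mu f k = 0) ->
  f =ae (fun _ => 0).
Proof.
move=> hf h0.
have ip p : trigpoly p -> cint mu (fun x => f x * p x) = 0.
  elim=> [k|p1 p2 t1 h1 t2 h2|c p' t h].
  - rewrite -(h0 (fun i => - k i)); congr cint; apply/funext => x.
    rewrite monomialJ; congr (_ * monomial _ _); apply/funext => i.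
    by rewrite opprK.
  - under eq_fun do rewrite mulrDr; rewrite cintD ?h1 ?h2 ?addr0 //;
      by apply: L2_mul => //; exact: trig_L2.
  - under eq_fun do rewrite mulrCA; rewrite cintZ ?h ?mulr0 //.
    by apply: L2_mul => //; exact: trig_L2.
have [f1 f2] : cintegrable mu f.
  have := L2_mul hf (L2_cst mu1 1).
  by under eq_fun do rewrite mulr1.
have z1 : {ae mu, forall x, complex.Re (f x) = 0}.
  apply: trig_orthogonal_ae0 => // s ts _.
  have := congr1 (@complex.Re R) (ip _ ts); rewrite /= => <-.
  by apply: eq_Rintegral => x _; rewrite cE /= mulr0 subr0.
have z2 : {ae mu, forall x, complex.Im (f x) = 0}.
  apply: trig_orthogonal_ae0 => // s ts _.
  have := congr1 (@complex.Im R) (ip _ ts); rewrite /= => <-.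
  by apply: eq_Rintegral => x _; rewrite cE /= mulr0 add0r.
by apply: filterS2 z1 z2 => x h1 h2; apply: complexP.
Qed.

Lemma cvg_pnorm2 (u : nat -> T -> C) f : (forall j, inL2 (u j)) -> inL2 f ->
  pnorm_pow mu 2 (fun x => u j x - f x) @[j --> \oo] --> 0%E ->
  nrm2 (fun x => u j x - f x) @[j --> \oo] --> 0.
Proof.
move=> hu hf /fine_cvgP[_ cv]; apply: cvg_trans cv; apply: near_eq_cvg.
by apply: nearW => j /=; rewrite pnorm2E //; exact: L2B.
Qed.

Lemma inner_lim0 (u : nat -> T -> C) f h : (forall j, inL2 (u j)) -> inL2 f ->
  nrm2 (fun x => u j x - f x) @[j --> \oo] --> 0 -> inL2 h ->
  (forall j, inner (u j) h = 0) -> inner f h = 0.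
Proof.
move=> hu hf uf hh u0.
have c : nrm (fun x => u j x - f x) * nrm h @[j --> \oo] --> 0 * nrm h.
  by apply: cvgMl; exact: (@nrm_cvg0 _ _ _ (fun j x => u j x - f x)).
apply: normc0_eq0; apply/eqP; rewrite eq_le normc_ge0 andbT -[leRHS](mul0r (nrm h)).
apply: (ler_cvg_to (cvg_cst _) c); apply: nearW => j.
have -> : Normc.normc (inner f h) = Normc.normc (inner (fun x => u j x - f x) h).
  by rewrite inner_subl // u0 sub0r normcN.
by apply: inner_le => //; exact: L2B.
Qed.

(** A common source of closedness: both H2 and the complement of [Q] in it are cut out by vanishing
    inner products. *)
Lemma orthogonal_closed (B : set (T -> C)) : (forall h, B h -> inL2 h) ->
  closed_subspace mu [set f | inL2 f /\ forall h, B h -> inner f h = 0].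
Proof.
move=> BL; split.
- by move=> f [].
- split; first exact: L2_cst.
  move=> h /BL hh; have := inner_scalel 0 (L2_cst mu1 0) hh.
  by rewrite !mul0r.
- move=> f g [hf f0] [hg g0]; split; first exact: L2D.
  by move=> h Bh; rewrite inner_addl ?f0 ?g0 ?addr0 //; exact: BL.
- move=> c f [hf f0]; split; first exact: L2Z.
  by move=> h Bh; rewrite inner_scalel ?f0 ?mulr0 //; exact: BL.
- move=> u f hu hf cv; split=> // h Bh.
  apply: (@inner_lim0 u) => //; [by move=> j; exact: (hu j).1| |exact: BL|].
    by apply: cvg_pnorm2 => // j; exact: (hu j).1.
  by move=> j; exact: (hu j).2.
Qed.

(** The L2-closure [S] of the polynomials is a closed subspace; the difference between [f] and its
    projection on [S] has no Fourier coefficient and so vanishes a.e. *)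
Lemma trig_dense f e : inL2 f -> 0 < e ->
  exists p, trigpoly p /\ nrm (fun x => f x - p x) < e.
Proof.
pose S := [set f | inL2 f /\ forall e, 0 < e ->
  exists p, trigpoly p /\ nrm (fun x => f x - p x) < e].
have tS p : trigpoly p -> S p.
  move=> tp; split; first exact: trig_L2.
  move=> d d0; exists p; split=> //.
  by under eq_fun do rewrite subrr; rewrite /L2norm nrm2_0 sqrtr0.
have hS : closed_subspace mu S.
  split.
  - by move=> g [].
  - by apply: tS; exact: trig_cst.
  - move=> g h [hg ag] [hh ah]; split; first exact: L2D.
    move=> d d0; have d2 : 0 < d / 2 by lra.
    have [p [tp hp]] := ag _ d2; have [q [tq hq]] := ah _ d2.
    exists (fun x => p x + q x); split; first exact: trigD.
    rewrite (_ : (fun x => _) = (fun x => (g x - p x) + (h x - q x))); last first.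
      by apply/funext => x; ring.
    apply: le_lt_trans (nrmD _ _) _; try (apply: L2B => //; exact: trig_L2).
    by lra.
  - move=> c g [hg ag]; split; first exact: L2Z.
    move=> d d0; have d2 : 0 < d / (Normc.normc c + 1).
      by rewrite divr_gt0 // ltr_wpDl ?normc_ge0.
    have [p [tp hp]] := ag _ d2; exists (fun x => c * p x); split; first exact: trigZ.
    rewrite (_ : (fun x => _) = (fun x => c * (g x - p x))); last first.
      by apply/funext => x; ring.
    rewrite nrmZ; last by apply: L2B => //; exact: trig_L2.
    move: hp; rewrite ltr_pdivlMr ?ltr_wpDl ?normc_ge0 //.
    have := nrm_ge0 mu (fun x => g x - p x); have := normc_ge0 c; nra.
  - move=> u g hu hg cv; split=> // d d0.
    have cv' : nrm2 (fun x => u j x - g x) @[j --> \oo] --> 0.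
      by apply: cvg_pnorm2 => // j; exact: (hu j).1.
    have [N _ hN] := cvgr_lt _ (@nrm_cvg0 _ _ _ (fun j x => u j x - g x) cv') (d / 2) ltac:(lra).
    have [uL ua] := hu N; have [p [tp hp]] := ua (d / 2) ltac:(lra).
    exists p; split=> //.
    apply: le_lt_trans (nrmB_tri hg uL (trig_L2 tp)) _; rewrite nrmBC.
    by have := hN N (leqnn N) => /=; lra.
move=> hf; have [g [Sg hg]] := proj_exists mu1 hS hf.
have gL := Sg.1.
have : (fun x => f x - g x) =ae (fun _ => 0).
  apply: fourier_complete; first exact: L2B.
  by move=> k; apply: hg; apply: tS; exact: trig_monomial.
move=> fg e0; have [p [tp hp]] := Sg.2 e e0; exists p; split=> //.
have Lp := trig_L2 tp.
rewrite /L2norm (_ : nrm2 _ = nrm2 (fun x => g x - p x)) //.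
apply: nrm2_ae; try (apply: cmeasurableB; exact: L2_meas).
- by apply: cmeasurableB; apply: L2_meas; [exact: hf|exact: Lp].
- by apply: cmeasurableB; apply: L2_meas; [exact: gL|exact: Lp].
- by apply: filterS fg => x /eqP; rewrite subr_eq0 => /eqP ->.
Qed.

End Completeness.

(** * Fejer means *)

Section Differences.
Variable n : nat.

Definition cube N := {ffun 'I_n -> 'I_N.+1}.

Definition dif N (p : cube N * cube N) : 'I_n -> int :=
  fun i => (p.1 i : nat)%:Z - (p.2 i : nat)%:Z.

(** Divided by (N+1)^n this is the Fejer weight, the product over i of max(0, 1 - |m_i| / (N+1)).
    Only its limit 1 matters below, so it is estimated and not computed. *)
Definition dif_count N (m : 'I_n -> int) := #|[pred p : cube N * cube N | dif p == m]|.

Lemma card_cube N : #|cube N| = (N.+1 ^ n)%N.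
Proof. by rewrite card_ffun !card_ord. Qed.

(** For a prescribed difference the second point of the pair determines the first. *)
Lemma dif_count_le N m : (dif_count N m <= N.+1 ^ n)%N.
Proof.
rewrite -card_cube /dif_count.
rewrite -(@card_in_image _ _ snd [pred p : cube N * cube N | dif p == m]).
  exact: max_card.
move=> [j l] [j' l'] /eqP h /eqP h' /= ll; rewrite -{}ll in h' *.
congr pair; apply/ffunP => i; apply: val_inj => /=.
have := congr1 (@^~ i) h; have := congr1 (@^~ i) h'; rewrite /dif /=; lia.
Qed.

(** If M bounds every |m_i|, a point with all coordinates in [M, N - M] can be translated by [m]
    inside the cube. The truncated subtraction covers N + 1 < 2 M. *)
Lemma dif_count_ge m : exists M, forall N,
  ((N.+1 - M.*2) ^ n <= dif_count N m)%N.
Proof.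
pose M := (\sum_(i < n) `|m i|)%N; exists M => N.
have mM i : (`|m i| <= M)%N by rewrite /M (bigD1 i) //= leq_addr.
set K := (N.+1 - M.*2)%N.
pose v (t : {ffun 'I_n -> 'I_K}) i := (M + t i)%N.
pose w (t : {ffun 'I_n -> 'I_K}) i := `|((M + t i)%N%:Z + m i)%R|%N.
have vN t i : (v t i < N.+1)%N by rewrite /v; have := ltn_ord (t i); lia.
have wE t i : (w t i)%:Z = (v t i)%:Z + m i.
  by rewrite /w /v; have := mM i; lia.
have wN t i : (w t i < N.+1)%N.
  by have := wE t i; rewrite /v; have := mM i; have := ltn_ord (t i); lia.
pose f t : cube N * cube N := ([ffun i => inord (w t i)], [ffun i => inord (v t i)]).
have finj : injective f.
  move=> t t' [_ /ffunP h]; apply/ffunP => i; apply: val_inj => /=.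
  have := congr1 val (h i); rewrite /= !ffunE !inordK // /v.
  exact: addnI.
have <- : #|{ffun 'I_n -> 'I_K}| = (K ^ n)%N by rewrite card_ffun !card_ord.
rewrite -(card_codom finj); apply: subset_leq_card; apply/fintype.subsetP => _ /codomP[t ->].
apply/eqP; apply: funext => i; rewrite /dif /f /= !ffunE !inordK //.
by rewrite wE addrC addKr.
Qed.

Lemma dif_density_cvg (R : realType) m :
  (dif_count N m)%:R / (N.+1 ^ n)%:R @[N --> \oo] --> (1 : R).
Proof.
have [M hM] := dif_count_ge m.
have p0 N : 0 < (N.+1 ^ n)%:R :> R by rewrite ltr0n expn_gt0.
have c : (1 - (M.*2)%:R * harmonic N) ^+ n @[N --> \oo] --> (1 : R).
  have h : 1 - (M.*2)%:R * harmonic N @[N --> \oo] --> (1 - (M.*2)%:R * 0 : R).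
    by apply: cvgB; [exact: cvg_cst|apply: cvgMr; exact: cvg_harmonic].
  have e1 : (1 - (M.*2)%:R * 0) ^+ n = 1 :> R by rewrite mulr0 subr0 expr1n.
  rewrite -[X in _ --> X]e1.
  apply: (@cvg_comp _ _ _ (fun N => 1 - (M.*2)%:R * harmonic N) (fun x : R => x ^+ n) _ _ _ h).
  exact: exprn_continuous.
apply: (@squeeze_cvgr _ _ _ _ (fun N => (1 - (M.*2)%:R * harmonic N) ^+ n) (fun _ => 1));
  [|exact: c|exact: cvg_cst].
(* From this rank on the natural subtraction is not truncated and agrees with the real one. *)
exists M.*2 => // N /= MN; apply/andP; split; last first.
  by rewrite ler_pdivrMr // mul1r ler_nat dif_count_le.
rewrite ler_pdivlMr // natrX -exprMn.
have -> : (1 - M.*2%:R * harmonic N) * N.+1%:R = (N.+1 - M.*2)%:R :> R.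
  by rewrite natrB ?(leqW MN) // mulrBl mul1r /= mulfVK.
by rewrite -natrX ler_nat.
Qed.

End Differences.

(** * Fejer means of a function bounded by 1 *)

Section Fejer.
Variables (R : realType) (n : nat) (mu : {measure set (torus R n) -> \bar R}).
Hypothesis hmu : is_torus_measure mu.
Local Notation C := R[i].
Local Notation T := (torus R n).
Local Notation "x %:C" := (real_complex R x) : ring_scope.
Local Notation inL2 := (inL2 mu).
Local Notation inner := (inner mu).
Local Notation nrm2 := (sqnorm mu).
Local Notation nrm := (L2norm mu).
Local Notation "f =ae g" := (Defs.ae_eq mu f g) (at level 70).
Implicit Types f g h : T -> C.
Let mu1 := torus_measureT hmu.

Lemma cint_sum I (r : seq I) (F : I -> T -> C) : (forall i, cintegrable mu (F i)) ->
  cintegrable mu (fun x => \sum_(i <- r) F i x) /\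
  cint mu (fun x => \sum_(i <- r) F i x) = \sum_(i <- r) cint mu (F i).
Proof.
move=> hF; elim: r => [|a r [IH1 IH2]].
  under eq_fun do rewrite big_nil; rewrite big_nil; split.
    by split; exact: (rint_cst mu1 0).
  by rewrite (cint_real mu (fun _ => 0)) Rintegral_cst // mul0r.
under eq_fun do rewrite big_cons; rewrite big_cons; split.
  exact: cintegrableD.
by rewrite cintD // IH2.
Qed.

Lemma trig_sum I (r : seq I) (F : I -> T -> C) : (forall i, trigpoly (F i)) ->
  trigpoly (fun x => \sum_(i <- r) F i x).
Proof.
move=> hF; elim: r => [|a r IH].
  by under eq_fun do rewrite big_nil; exact: trig_cst.
by under eq_fun do rewrite big_cons; exact: trigD.
Qed.

Lemma trigJ (p : T -> C) : trigpoly p -> trigpoly (fun x => (p x)^*).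
Proof.
elim=> [k|p1 p2 _ h1 _ h2|c q _ h].
- by under eq_fun do rewrite monomialJ; exact: trig_monomial.
- by under eq_fun do rewrite conjD; exact: trigD.
- by under eq_fun do rewrite conjM; exact: trigZ.
Qed.

Variable phi : T -> C.
Hypothesis mphi : cmeasurable phi.
Hypothesis phi1 : {ae mu, forall x, Normc.normc (phi x) <= 1}.

Lemma L2_contractive : inL2 phi.
Proof.
have := (L2M_ae mphi phi1 (L2_cst mu1 1)).1.
by under eq_fun do rewrite mulr1.
Qed.

(** Summing over pairs of cube points makes each frequency [m] occur [dif_count N m] times: the
    weights arise by counting, and the kernel is visibly a square. *)
Definition fejer N : T -> C := fun x => ((N.+1 ^ n)%:R^-1)%:C *
  \sum_(p : cube n N * cube n N) fourier mu phi (dif p) * monomial (dif p) x.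

Lemma trig_fejer N : trigpoly (fejer N).
Proof. by apply: trigZ; apply: trig_sum => p; apply: trigZ; exact: trig_monomial. Qed.

Let vec N (j : cube n N) : 'I_n -> int := fun i => (j i : nat)%:Z.

Lemma kernel_expand N (x y : T) :
  (\sum_(j : cube n N) monomial (vec j) x * (monomial (vec j) y)^*) *
  (\sum_(j : cube n N) monomial (vec j) x * (monomial (vec j) y)^*)^* =
  \sum_(p : cube n N * cube n N) monomial (dif p) x * (monomial (dif p) y)^* :> C.
Proof.
have -> : (\sum_(j : cube n N) monomial (vec j) x * (monomial (vec j) y)^*)^* =
    \sum_(j : cube n N) (monomial (vec j) x * (monomial (vec j) y)^*)^* :> C.
  exact: (rmorph_sum Num.conj).
rewrite big_distrlr /= pair_bigA /=; apply: eq_bigr => -[j l] _ /=.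
have e (z : T) : monomial (dif (j, l)) z = monomial (vec j) z * (monomial (vec l) z)^* :> C.
  by rewrite monomialJ -monomialM.
by rewrite !e !conjM !conjCK; ring.
Qed.

Lemma cintegrable_trig (p : T -> C) : trigpoly p -> cintegrable mu p.
Proof.
move=> tp; have := L2_mul (trig_L2 hmu tp) (L2_cst mu1 1).
by under eq_fun do rewrite mulr1.
Qed.

(* The Fejer kernel is [|D|^2 / |D|_2^2] for the Dirichlet kernel [D] of the cube. *)
Lemma normc_fejer_le N x : Normc.normc (fejer N x) <= 1.
Proof.
pose D y := \sum_(j : cube n N) monomial (vec j) x * (monomial (vec j) y)^* : C.
have tD : trigpoly D.
  by apply: trig_sum => j; apply: trigZ; apply: trigJ; exact: trig_monomial.
have LD := trig_L2 hmu tD.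
pose c : R := (N.+1 ^ n)%:R.
have c0 : 0 < c by rewrite ltr0n expn_gt0.
(* Integration over y keeps only the diagonal pairs, one for each point of the cube. *)
have ND : nrm2 D = c.
  apply: (@complexI R); rewrite -inner_nrm2 /Defs.inner.
  under eq_fun do rewrite kernel_expand.
  rewrite (cint_sum _ _).2; last first.
    by move=> p; apply: cintegrableZ; apply: cintegrable_trig; apply: trigJ; exact: trig_monomial.
  rewrite (eq_bigr (fun p => if p.1 == p.2 then 1 else 0)); last first.
    move=> -[j l] _ /=; rewrite cintZ; last first.
      by apply: cintegrable_trig; apply: trigJ; exact: trig_monomial.
    rewrite (_ : (fun y => _) = monomial (fun i => - dif (j, l) i)); last first.
      by apply/funext => y; rewrite monomialJ.
    rewrite cint_monomial //.
    have [->|jl] := eqVneq j l.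
      rewrite (_ : (fun i => _) = (fun _ => 0)); last first.
        by apply/funext => i; rewrite /dif /= subrr oppr0.
      rewrite eqxx mulr1 (_ : dif _ = (fun _ => 0)) ?monomial0 //.
      by apply/funext => i; rewrite /dif /= subrr.
    case: eqP => [h|_]; last by rewrite mulr0.
    case/eqP: jl; apply/ffunP => i; apply: val_inj => /=.
    by have := congr1 (@^~ i) h; rewrite /dif /=; lia.
  rewrite -(pair_bigA _ (fun j l : cube n N => if j == l then 1 else 0 : C)) /=.
  rewrite (eq_bigr (fun _ => 1)); last first.
    by move=> j _; rewrite -big_mkcond /= (big_pred1 j) // => l; rewrite eq_sym.
  by rewrite sumr_const card_cube /c rmorph_nat.
(* Written in this way, the mean is bounded by |phi D| |D| / c <= |D|^2 / c = 1 through
   Cauchy-Schwarz. *)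
have E : fejer N x = (c^-1)%:C * inner (fun y => phi y * D y) D.
  rewrite /fejer -/c; congr (_ * _); rewrite /Defs.inner.
  have -> : (fun y => phi y * D y * (D y)^*) = (fun y => \sum_(p : cube n N * cube n N)
      monomial (dif p) x * (phi y * (monomial (dif p) y)^*)).
    apply/funext => y; rewrite -mulrA kernel_expand mulr_sumr.
    by apply: eq_bigr => p _; rewrite mulrCA.
  have ci (p : cube n N * cube n N) : cintegrable mu (fun y => phi y * (monomial (dif p) y)^*).
    by apply: L2_mulJ; [exact: L2_contractive|exact: L2_monomial].
  rewrite (cint_sum _ _).2; last by move=> p; apply: cintegrableZ; exact: ci.
  by apply: eq_bigr => p _; rewrite cintZ // mulrC.
have [Lpd npd] := L2M_ae mphi phi1 LD.
have cn : `|c^-1| = c^-1 by rewrite ger0_norm // invr_ge0 ltW.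
rewrite E Normc.normcM normcR cn mulrC ler_pdivrMr // mul1r.
apply: le_trans (inner_le Lpd LD) _.
have h : nrm (fun y => phi y * D y) <= nrm D by rewrite /L2norm ler_sqrt ?nrm2_ge0.
rewrite -ND -sqr_nrm expr2 ler_wpM2r ?nrm_ge0 //.
Qed.

(** The pairing carries no conjugate, so [z^k] selects the pairs whose difference is -k. *)
Lemma cint_fejer_monomial N k : cint mu (fun x => fejer N x * monomial k x) =
  ((dif_count N (fun i => - k i))%:R / (N.+1 ^ n)%:R)%:C *
  cint mu (fun x => phi x * monomial k x).
Proof.
pose c : C := ((N.+1 ^ n)%:R^-1)%:C; pose m i := - k i.
have -> : cint mu (fun x => phi x * monomial k x) = fourier mu phi m.
  congr cint; apply/funext => x; rewrite monomialJ; congr (_ * monomial _ _).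
  by apply/funext => i; rewrite /m opprK.
have -> : (fun x => fejer N x * monomial k x) = (fun x =>
    \sum_(p : cube n N * cube n N) (c * fourier mu phi (dif p)) *
      monomial (fun i => dif p i + k i) x).
  apply/funext => x; rewrite /fejer -/c -mulrA mulr_suml mulr_sumr.
  by apply: eq_bigr => p _; rewrite monomialM !mulrA.
rewrite (cint_sum _ _).2; last first.
  by move=> p; apply: cintegrableZ; apply: cintegrable_trig; exact: trig_monomial.
rewrite (eq_bigr (fun p => if dif p == m then c * fourier mu phi m else 0)); last first.
  move=> p _; rewrite cintZ; last by apply: cintegrable_trig; exact: trig_monomial.
  rewrite cint_monomial //.
  have -> : ((fun i => dif p i + k i) == (fun _ => 0)) = (dif p == m).
    apply/eqP/eqP => [h|->]; apply/funext => i; last by rewrite /m addNr.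
    by have := congr1 (@^~ i) h => /eqP; rewrite addr_eq0 => /eqP.
  by case: eqP => [->|_]; rewrite ?mulr1 ?mulr0.
rewrite -big_mkcond sumr_const -/(dif_count N m) -[LHS]mulr_natl mulrA; congr (_ * _).
by rewrite rmorphM rmorph_nat.
Qed.

Lemma fejer_weak_cvg p : trigpoly p ->
  Normc.normc (cint mu (fun x => phi x * p x) - cint mu (fun x => fejer N x * p x))
    @[N --> \oo] --> 0.
Proof.
have Lphi := L2_contractive.
have LF N := trig_L2 hmu (trig_fejer N).
elim=> [k|p1 p2 t1 h1 t2 h2|c q t h].
- set a := cint mu (fun x => phi x * monomial k x).
  under eq_fun do rewrite cint_fejer_monomial -/a.
  pose d N : R := (dif_count N (fun i => - k i))%:R / (N.+1 ^ n)%:R.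
  have -> : (fun N => Normc.normc (a - (d N)%:C * a)) = (fun N => `|1 - d N| * Normc.normc a).
    apply/funext => N; rewrite -{1}[a]mul1r -mulrBl Normc.normcM; congr (_ * _).
    by rewrite -normcR rmorphB rmorph1.
  rewrite -(mul0r (Normc.normc a)); apply: cvgMl.
  have -> : 0 = `|1 - 1| :> R by rewrite subrr normr0.
  by apply: cvg_norm; apply: cvgB; [exact: cvg_cst|exact: dif_density_cvg].
- have [L1 L2] := (trig_L2 hmu t1, trig_L2 hmu t2).
  pose F (q : T -> C) N := Normc.normc (cint mu (fun x => phi x * q x) -
    cint mu (fun x => fejer N x * q x)).
  have s : F p1 N + F p2 N @[N --> \oo] --> (0 + 0 : R) by apply: cvgD.
  rewrite addr0 in s; rewrite -/(F (fun x => p1 x + p2 x)).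
  apply: (squeeze_cvgr _ (cvg_cst 0) s); apply: nearW => N; rewrite normc_ge0 /= /F.
  have -> : cint mu (fun x => phi x * (p1 x + p2 x)) =
      cint mu (fun x => phi x * p1 x) + cint mu (fun x => phi x * p2 x).
    by rewrite -cintD; [under eq_fun do rewrite mulrDr|exact: L2_mul|exact: L2_mul].
  have -> : cint mu (fun x => fejer N x * (p1 x + p2 x)) =
      cint mu (fun x => fejer N x * p1 x) + cint mu (fun x => fejer N x * p2 x).
    by rewrite -cintD; [under eq_fun do rewrite mulrDr|exact: L2_mul|exact: L2_mul].
  apply: le_trans (le_normcD _ _); rewrite le_eqVlt; apply/orP; left; apply/eqP.
  by congr Normc.normc; ring.
- have Lq := trig_L2 hmu t.
  pose F (q : T -> C) N := Normc.normc (cint mu (fun x => phi x * q x) -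
    cint mu (fun x => fejer N x * q x)).
  have s : Normc.normc c * F q N @[N --> \oo] --> Normc.normc c * 0 by apply: cvgMr.
  rewrite mulr0 in s; rewrite -/(F (fun x => c * q x)).
  rewrite (_ : F _ = (fun N => Normc.normc c * F q N)) //.
  have e (f : T -> C) : inL2 f ->
      cint mu (fun x => f x * (c * q x)) = c * cint mu (fun x => f x * q x).
    move=> Lf; rewrite -cintZ; last exact: L2_mul.
    by congr cint; apply/funext => x; rewrite mulrCA.
  by apply/funext => N; rewrite /F !e // -mulrBr Normc.normcM.
Qed.

(* [phi] and its Fejer means are uniformly bounded by 1, so weak convergence on
   trigonometric polynomials extends to all of L2. *)
Lemma inner_fejer_close g q e : inL2 g -> inL2 q -> 0 < e ->
  exists N, Normc.normc (inner (fun x => phi x * g x) q -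
                    inner (fun x => fejer N x * g x) q) <= e.
Proof.
move=> Lg Lq e0.
(* Replacing [g] and [q] by polynomials costs at most d (|g| + |q| + 1), once for [phi] and once for
   its mean; d <= 1 serves to bound |p| by |g| + 1. *)
pose K := 2 * (nrm g + nrm q + 1) + 1.
have [g0 q0] := (nrm_ge0 mu g, nrm_ge0 mu q).
have K0 : 1 <= K by rewrite /K; lra.
pose d := Num.min 1 (e / (2 * K)).
have d0 : 0 < d.
  by rewrite lt_min ltr01 /= divr_gt0 //; lra.
have d1 : d <= 1 by rewrite ge_min lexx.
have dK : d * K <= e / 2.
  have : d <= e / (2 * K) by rewrite ge_min lexx orbT.
  rewrite ler_pdivlMr; last by lra.
  by lra.
have [p [tp hp]] := trig_dense hmu Lg d0.
have [r [tr hr]] := trig_dense hmu Lq d0.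
have [Lp Lr] := (trig_L2 hmu tp, trig_L2 hmu tr).
have tpr : trigpoly (fun x => p x * (r x)^*) by apply: trigM => //; exact: trigJ.
have [N _ hN] := cvgr_le _ (fejer_weak_cvg tpr) (e / 2) ltac:(lra).
have {}hN : Normc.normc (cint mu (fun x => phi x * (p x * (r x)^*)) -
  cint mu (fun x => fejer N x * (p x * (r x)^*))) <= e / 2 := hN N (leqnn N).
exists N.
have B (f : T -> C) u v : cmeasurable f -> {ae mu, forall x, Normc.normc (f x) <= 1} ->
    inL2 u -> inL2 v -> Normc.normc (inner (fun x => f x * u x) v) <= nrm u * nrm v.
  move=> mf f1 Lu Lv; have [L h] := L2M_ae mf f1 Lu.
  apply: le_trans (inner_le L Lv) _; rewrite ler_wpM2r ?nrm_ge0 //.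
  by rewrite /L2norm ler_sqrt ?nrm2_ge0.
have key (f : T -> C) : cmeasurable f -> {ae mu, forall x, Normc.normc (f x) <= 1} ->
    Normc.normc (inner (fun x => f x * g x) q - cint mu (fun x => f x * (p x * (r x)^*)))
    <= d * (nrm g + nrm q + 1).
  move=> mf f1.
  have Lb : inL2 (fun x => g x - p x) by exact: L2B.
  have Lc : inL2 (fun x => q x - r x) by exact: L2B.
  have Lfp := (L2M_ae mf f1 Lp).1; have Lfg := (L2M_ae mf f1 Lg).1.
  have -> : inner (fun x => f x * g x) q - cint mu (fun x => f x * (p x * (r x)^*)) =
     inner (fun x => f x * (g x - p x)) q + inner (fun x => f x * p x) (fun x => q x - r x).
    have -> : cint mu (fun x => f x * (p x * (r x)^*)) = inner (fun x => f x * p x) r.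
      by congr cint; apply/funext => x; rewrite mulrA.
    rewrite inner_subr //; under [in RHS]eq_fun do rewrite mulrBr.
    by rewrite inner_subl //; ring.
  apply: le_trans (le_normcD _ _) _.
  have h1 := B _ _ _ mf f1 Lb Lq; have h2 := B _ _ _ mf f1 Lp Lc.
  have np : nrm p <= nrm g + d.
    have -> : p = (fun x => g x - (g x - p x)) by apply/funext => x; ring.
    by apply: le_trans (nrmB Lg Lb) _; rewrite lerD2l ltW.
  have := nrm_ge0 mu p; have := nrm_ge0 mu (fun x => g x - p x).
  have := nrm_ge0 mu (fun x => q x - r x); nra.
have k1 := key _ mphi phi1.
have F1 : {ae mu, forall x, Normc.normc (fejer N x) <= 1}.
  by apply: nearW => x; exact: normc_fejer_le.
have k2 := key _ (trig_meas (trig_fejer N)) F1.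
move: k1 k2 hN.
set A := inner (fun x => phi x * g x) q; set B' := inner (fun x => fejer N x * g x) q.
set A' := cint mu (fun x => phi x * _); set B'' := cint mu (fun x => fejer N x * _).
move=> k1 k2 hN.
have -> : A - B' = (A - A') + ((A' - B'') + (B'' - B')) by ring.
apply: le_trans (le_normcD _ _) _; have := le_normcD (A' - B'') (B'' - B').
by rewrite (normcB B'' B'); move: dK; rewrite /K; lra.
Qed.

(** In a Fejer mean the terms with frequency outside Z_+^n have coefficient 0 and the others are
    killed by the hypothesis, so every mean gives exactly 0. *)
Lemma analytic_orthogonal g q : (forall k, ~ in_Zplus k -> fourier mu phi k = 0) ->
  inL2 g -> inL2 q ->
  (forall k, in_Zplus k -> inner (fun x => monomial k x * g x) q = 0) ->
  inner (fun x => phi x * g x) q = 0.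
Proof.
move=> ph0 Lg Lq h0.
have Fz N : inner (fun x => fejer N x * g x) q = 0.
  pose c : C := ((N.+1 ^ n)%:R^-1)%:C.
  have Lm k : inL2 (fun x => monomial k x * g x).
    apply: L2M_bounded => //; first exact: cmeasurable_monomial.
    by move=> x; rewrite normc_monomial.
  rewrite /Defs.inner (_ : (fun x => _) = (fun x => \sum_(p : cube n N * cube n N)
     (c * fourier mu phi (dif p)) * (monomial (dif p) x * g x * (q x)^*))); last first.
    apply/funext => x; rewrite /fejer -/c -!mulrA mulr_suml mulr_sumr.
    by apply: eq_bigr => p _; rewrite !mulrA.
  rewrite (cint_sum _ _).2; last by move=> p; apply: cintegrableZ; exact: L2_mulJ.
  apply: big1 => p _; rewrite cintZ; last exact: L2_mulJ.
  have [kp|/ph0 ->] := pselect (in_Zplus (dif p)); last by rewrite mulr0 mul0r.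
  by rewrite -/(Defs.inner mu (fun x => monomial (dif p) x * g x) q) h0 // mulr0.
apply: normc0_eq0; apply/eqP; rewrite eq_le normc_ge0 andbT.
apply/ler_addgt0Pl => e e0; rewrite addr0.
by have [N] := inner_fejer_close Lg Lq e0; rewrite Fz subr0.
Qed.

End Fejer.

(** * Quotient modules and the lifting theorem *)

Section Hardy.
Variables (R : realType) (n : nat) (mu : {measure set (torus R n) -> \bar R}).
Hypothesis hmu : is_torus_measure mu.
Local Notation C := R[i].
Local Notation T := (torus R n).
Local Notation "x %:C" := (real_complex R x) : ring_scope.
Local Notation inL2 := (inL2 mu).
Local Notation inner := (inner mu).
Local Notation nrm2 := (sqnorm mu).
Local Notation nrm := (L2norm mu).
Local Notation fourier := (fourier mu).
Local Notation inH2 := (inH2 mu).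
Local Notation "f =ae g" := (Defs.ae_eq mu f g) (at level 70).
Implicit Types f g h q : T -> C.
Let mu1 := torus_measureT hmu.

Lemma fourierE f k : fourier f k = inner f (monomial k).
Proof. by []. Qed.

Lemma H2_closed : closed_subspace mu inH2.
Proof.
pose B := [set h | exists2 k, ~ in_Zplus k & h = monomial k :> (T -> C)].
have -> : inH2 = [set f | inL2 f /\ forall h, B h -> inner f h = 0].
  apply/seteqP; split => f [Lf h]; split=> //.
    by move=> _ [k kZ ->]; exact: h.
  by move=> k kZ; apply: h; exists k.
by apply: orthogonal_closed => // _ [k _ ->]; exact: L2_monomial.
Qed.

Lemma H2_monomial k : in_Zplus k -> inH2 (monomial k).
Proof.
move=> kZ; split; first exact: L2_monomial.
move=> l lZ; rewrite fourierE inner_monomial //.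
by case: eqP => // kl; case: lZ; rewrite -kl.
Qed.

Lemma L2M_monomial k f : inL2 f -> inL2 (fun x => monomial k x * f x).
Proof.
move=> Lf; apply: L2M_bounded => //; first exact: cmeasurable_monomial.
by move=> x; rewrite normc_monomial.
Qed.

Lemma H2M_monomial k f : in_Zplus k -> inH2 f -> inH2 (fun x => monomial k x * f x).
Proof.
move=> kZ [Lf f0]; split; first exact: L2M_monomial.
move=> l lZ; rewrite -(f0 (fun i => l i - k i)); last first.
  by move=> h; apply: lZ => i; have := addr_ge0 (h i) (kZ i); rewrite subrK.
congr cint; apply/funext => x.
have -> : monomial (fun i => l i - k i) x = monomial l x * (monomial k x)^* :> C.
  by rewrite monomialJ -monomialM.
by rewrite conjM conjCK; ring.
Qed.

Lemma H2_cst (c : C) : inH2 (fun _ => c).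
Proof.
have Z0 : in_Zplus (fun _ : 'I_n => 0) by [].
have := subspaceZ H2_closed c (H2_monomial Z0).
by under eq_fun do rewrite monomial0 mulr1.
Qed.

(** The projection of [f] on H2 has no Fourier coefficient at all and vanishes by completeness; this
    is density of analytic polynomials in dual form. *)
Lemma H2_perp f g : inL2 f -> (forall k, in_Zplus k -> fourier f k = 0) ->
  inH2 g -> inner g f = 0.
Proof.
move=> Lf f0 Hg; have Lg := Hg.1.
have [h [Hh hp]] := proj_exists mu1 H2_closed Lf; have Lh := Hh.1.
have h0 : h =ae (fun _ => 0).
  apply: (fourier_complete hmu Lh) => k.
  have [kZ|kZ] := pselect (in_Zplus k); last exact: Hh.2.
  have := hp _ (H2_monomial kZ); rewrite inner_subl //; last exact: L2_monomial.
  have e : inner f (monomial k) = 0 by exact: f0.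
  by rewrite e sub0r => /eqP; rewrite oppr_eq0 => /eqP.
have fg : inner f g = 0.
  have := hp _ Hg; rewrite inner_subl //.
  rewrite (_ : inner h g = 0) ?subr0 //.
  rewrite (@inner_ae _ _ _ _ _ (fun _ => 0) g); try exact: L2_meas.
  - by have := inner_scalel 0 (L2_cst mu1 0) Lg; rewrite !mul0r.
  - exact: L2_meas Lh.
  - exact: L2_meas Lg.
  - exact: cmeasurable_cst.
  - exact: L2_meas Lg.
  - exact: h0.
  - by apply: nearW.
by rewrite (inner_conj Lf Lg) fg conjC0.
Qed.

(** Exponents are built one coordinate at a time because the module structure speaks only of the
    [z_i]. *)
Lemma Zplus_ind (P : ('I_n -> int) -> Prop) : P (fun _ => 0) ->
  (forall k i, in_Zplus k -> P k -> P (fun j => (j == i)%:R + k j)) ->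
  forall k, in_Zplus k -> P k.
Proof.
move=> P0 PS k; have [m] := ubnP (\sum_(i < n) `|k i|)%N.
elim: m k => // m IH k km kZ.
have [[i ki]|k0] := pselect (exists i, k i != 0); last first.
  rewrite (_ : k = (fun _ => 0)) //; apply/funext => i; apply/eqP.
  by apply: contrapT => /negP ki; apply: k0; exists i.
pose l j := k j - (j == i)%:R.
have ki1 : 1 <= k i by have := kZ i; move: ki; lia.
have lZ : in_Zplus l.
  by move=> j; rewrite /l; case: eqP => [->|_] /=; [lia|have := kZ j; lia].
rewrite (_ : k = (fun j => (j == i)%:R + l j)); last first.
  by apply/funext => j; rewrite /l addrC subrK.
apply: PS => //; apply: IH => //.
apply: (@leq_trans (\sum_(j < n) `|k j|)%N); last by rewrite -ltnS.
rewrite (bigD1 i) //= [in X in (_ < X)%N](bigD1 i) //=.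
rewrite -addSn; apply: leq_add; first by rewrite /l eqxx; lia.
by apply: leq_sum => j /negbTE ji; rewrite /l ji subr0.
Qed.

(** * A quotient module and its complementary submodule *)

Section QuotientModule.
Variable Q : set (T -> C).
Hypothesis hQ : quotient_module mu Q.

Lemma quotient_closed : closed_subspace mu Q.
Proof. by case: hQ. Qed.

Lemma quotient_H2 f : Q f -> inH2 f.
Proof. by case: hQ => _ h _; exact: h. Qed.

Lemma quotient_L2 f : Q f -> inL2 f.
Proof. by move/quotient_H2 => []. Qed.

(** The adjoint is given as a relation, so a representative has to be produced: the projection on H2
    of conj(z_i) q. *)
Lemma backward_shift i q : Q q -> exists g, Q g /\
  forall h, inH2 h -> inner (fun x => zcoord i x * h x) q = inner h g.
Proof.
move=> Qq; have Lq := quotient_L2 Qq.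
have zE : (zcoord i : T -> C) = monomial (fun j => (j == i)%:R).
  by apply/funext => x; exact: zcoordE.
have Lzq : inL2 (fun x => (zcoord i x)^* * q x).
  rewrite zE; under eq_fun do rewrite monomialJ; exact: L2M_monomial.
have [g [Hg gp]] := proj_exists mu1 H2_closed Lzq.
have adj h : inH2 h -> inner g h = inner q (fun x => zcoord i x * h x).
  move=> Hh; have := gp _ Hh; rewrite inner_subl //; [|exact: Hg.1|exact: Hh.1].
  move/eqP; rewrite subr_eq0 => /eqP <-; congr cint; apply/funext => x.
  by rewrite conjM; ring.
exists g; split; first by case: hQ => _ _ h; apply: (h i q g).
move=> h Hh; rewrite (inner_conj Hg.1 Hh.1) adj // -inner_conj //.
by rewrite zE; apply: L2M_monomial; exact: Hh.1.
Qed.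

(** The submodule H2 (-) Q. *)
Definition perpQ g := inH2 g /\ forall q, Q q -> inner g q = 0.

Lemma perpQ_closed : closed_subspace mu perpQ.
Proof.
pose B := [set h | (exists2 k, ~ in_Zplus k & h = monomial k :> (T -> C)) \/ Q h].
have -> : perpQ = [set f | inL2 f /\ forall h, B h -> inner f h = 0].
  apply/seteqP; split => f.
    move=> [[Lf f0] fQ]; split=> // _ [[k kZ ->]|/fQ //]; exact: f0.
  move=> [Lf h]; split; last by move=> q Qq; apply: h; right.
  by split=> // k kZ; apply: h; left; exists k.
apply: orthogonal_closed => // h [[k _ ->]|]; first exact: L2_monomial.
exact: quotient_L2.
Qed.

(** Each factor [z_i] is moved onto [q] as a backward shift, which stays in [Q]. *)
Lemma perpQ_monomial k g q : in_Zplus k -> perpQ g -> Q q ->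
  inner (fun x => monomial k x * g x) q = 0.
Proof.
move=> kZ [Hg gQ]; move: k kZ q; apply: Zplus_ind => [q Qq|k i kZ IH q Qq].
  by under eq_fun do rewrite monomial0 mul1r; exact: gQ.
have [q' [Qq' adj]] := backward_shift i Qq.
rewrite -(IH _ Qq') -adj; last exact: H2M_monomial.
by congr cint; apply/funext => x; rewrite monomialM -zcoordE !mulrA.
Qed.

Lemma schur_L2 phi : in_schur mu phi -> inL2 phi.
Proof. by case=> m1 m2 _; exact: (L2_contractive hmu). Qed.

Lemma schur_H2 phi : in_schur mu phi -> inH2 phi.
Proof. by move=> h; split; [exact: schur_L2|case: h]. Qed.

Lemma schur_perp phi g q : in_schur mu phi -> perpQ g -> Q q ->
  inner (fun x => phi x * g x) q = 0.
Proof.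
move=> [m1 m2 m3] gp Qq; apply: (analytic_orthogonal hmu) => //.
- exact: gp.1.1.
- exact: quotient_L2.
- by move=> k kZ; exact: perpQ_monomial.
Qed.

Lemma norm1E f : inL2 f ->
  norm1 mu f = (Rintegral mu setT (fun x => Normc.normc (f x)))%:E.
Proof.
move=> Lf; rewrite /Rintegral fineK //.
have := L2_mul Lf (L2_cst mu1 1); under eq_fun do rewrite mulr1.
by move/rint_normc/(integrable_fin_num measurableT).
Qed.

(** The coefficient of conj(m + h) at k in Z_+^n is the conjugate of that of m + h at -k, where [m]
    has none and [h] could have one only for k = 0. Hence a function in H2 sees only the [Q^conj]
    part of an element of [M_Q]. *)
Lemma Mn_H20_perp f m h : inMn mu m -> inH20 mu h -> inH2 f ->
  inner f (fun x => (m x + h x)^*) = 0.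
Proof.
move=> [Lm m0] [Hh h0] Hf; have Lh := Hh.1.
apply: H2_perp => //; first by apply: L2J; exact: L2D.
move=> k kZ.
have e0 (g : T -> C) : inL2 g -> fourier g (fun i => - k i) = 0 ->
    fourier (fun x => (g x)^*) k = 0.
  move=> Lg g0; rewrite -conjC0 -g0 -cintJ; last by apply: L2_mulJ => //; exact: L2_monomial.
  by congr cint; apply/funext => x; rewrite -monomialJ conjM !conjCK.
apply: (e0 (fun x => m x + h x)); first exact: L2D.
rewrite fourierE inner_addl //; last exact: L2_monomial.
have -> : inner m (monomial (fun i => - k i)) = 0.
  by apply: m0; right => i; rewrite oppr_le0.
rewrite add0r; have [Z|] := pselect (in_Zplus (fun i => - k i)); last exact: Hh.2.
rewrite (_ : (fun i => - k i) = (fun _ => 0)) //; apply/funext => i.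
by apply/eqP; rewrite eq_le oppr_le0 kZ Z.
Qed.

Lemma is_proj_sub S f g h : closed_subspace mu S -> inL2 f -> is_proj mu S f g ->
  S h -> inner f h = inner g h.
Proof.
move=> hS Lf [Sg p] Sh; have := p _ Sh; rewrite inner_subl //; try exact: subspace_L2 hS _ _.
by move/eqP; rewrite subr_eq0 => /eqP.
Qed.

(** * The two implications between lifting and contractivity *)

Variables (X : (T -> C) -> (T -> C)) (PQ1 : T -> C).
Hypothesis hX : contraction_on mu Q X.
Hypothesis hP : is_proj mu Q (fun _ => 1) PQ1.

Lemma X_Q f : Q f -> Q (X f).
Proof. by case: hX => h _ _ _; exact: h. Qed.

Lemma X_L2 f : Q f -> inL2 (X f).
Proof. by move=> Qf; apply: quotient_L2; exact: X_Q. Qed.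

Lemma perpQ_1_PQ1 : perpQ (fun x => 1 - PQ1 x).
Proof.
split; last exact: hP.2.
by apply: (subspaceB H2_closed); [exact: H2_cst|exact: quotient_H2 hP.1].
Qed.

Lemma liftable_contractive : liftable mu Q X -> XQ_contractive mu Q (X PQ1).
Proof.
move=> [phi [sphi lift]] f [q [m [h [Qq mm hh fE]]]].
have [Lq Lm Lh] : [/\ inL2 q, inL2 m & inL2 h].
  by split; [exact: quotient_L2|exact: mm.1|exact: hh.1.1].
have Lphi := schur_L2 sphi; have Q1 := hP.1.
set psi := X PQ1; have Qpsi : Q psi by exact: X_Q.
have Lpsi := quotient_L2 Qpsi.
have Lf : inL2 f.
  rewrite (_ : f = (fun x => (q x)^* + m x + h x)); last by apply/funext.
  by apply: L2D => //; apply: L2D => //; exact: L2J.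
have pq : inner psi q = inner phi q.
  have [_ p] := lift _ Q1; have := p _ Qq.
  have LpP : inL2 (fun x => phi x * PQ1 x).
    by case: sphi => ? ? _; apply: (L2M_ae _ _ (quotient_L2 Q1)).1.
  rewrite inner_subl // => /eqP; rewrite subr_eq0 => /eqP <-.
  have := schur_perp sphi perpQ_1_PQ1 Qq; under eq_fun do rewrite mulrBr mulr1.
  by rewrite inner_subl // => /eqP; rewrite subr_eq0 => /eqP.
have LfJ g : inH2 g -> cint mu (fun x => g x * f x) = inner g q.
  move=> Hg; have Lg := Hg.1.
  have -> : cint mu (fun x => g x * f x) = inner g (fun x => q x + (m x + h x)^*).
    by congr cint; apply/funext => x; rewrite fE conjD conjCK addrA.
  rewrite inner_addr // ?Mn_H20_perp ?addr0 //; apply: L2J; exact: L2D.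
rewrite LfJ; last exact: quotient_H2.
rewrite pq -LfJ; last exact: schur_H2.
have ci := L2_mul Lphi Lf.
apply: (@le_trans _ _ (norm1 mu (fun x => phi x * f x))); last first.
  have m1 : measurable_fun setT (fun x => (Normc.normc (phi x * f x) ^+ 1)%:E).
    by apply/measurable_EFinP; apply: measurable_normcX; exact: cintegrable_meas ci.
  have m2 : measurable_fun setT (fun x => (Normc.normc (f x) ^+ 1)%:E).
    by apply/measurable_EFinP; apply: measurable_normcX; exact: L2_meas Lf.
  apply: ae_ge0_le_integral => //; try by move=> x _; rewrite lee_fin expr1 normc_ge0.
  case: sphi => _ phi1 _; apply: filterS phi1 => x h1 _; rewrite lee_fin !expr1.
  by rewrite Normc.normcM ler_piMl ?normc_ge0.
rewrite /norm1 /pnorm_pow -[leRHS]fineK.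
  by rewrite lee_fin; exact: normc_cint_le ci.
exact: (integrable_fin_num measurableT (rint_normc ci)).
Qed.

(** The analytic part [h0] of [w] is orthogonal to H2 (-) Q, hence lies in [Q]. The rest has no
    frequency in Z_+^n, so its conjugate has none in Z_-^n and splits into an [M_n] part and an
    [H^2_0] part. *)
Lemma perp_perpQ_MQ w : inL2 w -> (forall g, perpQ g -> inner w g = 0) ->
  in_MQ mu Q (fun x => (w x)^*).
Proof.
move=> Lw wp.
have [h0 [Hh0 hp0]] := proj_exists mu1 H2_closed Lw; have Lh0 := Hh0.1.
have [q0 [Qq0 qp0]] := proj_exists mu1 quotient_closed Lh0.
have Hq0 := quotient_H2 Qq0; have Lq0 := Hq0.1.
pose e x := h0 x - q0 x.
have pe : perpQ e by split=> //; exact: subspaceB H2_closed _ _ Hh0 Hq0.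
have Le : inL2 e by exact: pe.1.1.
have Qh0 : Q h0.
  (* The component of [h0] in H2 (-) Q is orthogonal to [w], to w - h0 and to [q0], hence to
     itself. *)
  have e0 : inner e e = 0.
    have -> : inner e e = inner h0 e - inner q0 e by rewrite {1}/e inner_subl.
    have -> : inner q0 e = 0 by rewrite (inner_conj Le Lq0) pe.2 // conjC0.
    by have := hp0 _ pe.1; rewrite inner_subl // wp // sub0r subr0 => /eqP; rewrite oppr_eq0 => /eqP.
  apply: (subspace_ae quotient_closed _ Qq0); first exact: L2_meas Lh0.
  move: e0; rewrite inner_nrm2 => /eqP; rewrite (inj_eq (@complexI R)) => /eqP /(nrm2_eq0 Le).
  by apply: filterS => x /eqP; rewrite subr_eq0 => /eqP ->.
pose r x := w x - h0 x.
have Lr : inL2 r by exact: L2B.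
have r0 k : in_Zplus k -> inner r (monomial k) = 0.
  by move=> kZ; apply: hp0; exact: H2_monomial.
have LrJ := L2J Lr.
have rJ0 k : in_Zminus k -> inner (fun x => (r x)^*) (monomial k) = 0.
  move=> kZ; rewrite -conjC0 -(r0 (fun i => - k i)); last by move=> i; rewrite oppr_ge0.
  rewrite -cintJ; last by apply: L2_mulJ => //; exact: L2_monomial.
  by congr cint; apply/funext => x; rewrite -monomialJ conjM !conjCK.
(* The projection on H2 separates the two parts; its coefficient at 0 vanishes because 0 is also in
   Z_-^n. *)
have [hh [Hhh php]] := proj_exists mu1 H2_closed LrJ; have Lhh := Hhh.1.
exists h0, (fun x => (r x)^* - hh x), hh; split=> //.
- split; first exact: L2B.
  move=> k; have [kZ _|kZ [//|kM]] := pselect (in_Zplus k).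
    by apply: php; exact: H2_monomial.
  rewrite fourierE inner_subl //; last exact: L2_monomial.
  by rewrite rJ0 // sub0r [X in - X](Hhh.2 k kZ) oppr0.
- split=> //.
  have Z0 : in_Zplus (fun _ : 'I_n => 0) by [].
  have := php _ (H2_monomial Z0); rewrite inner_subl //; last exact: L2_monomial.
  by rewrite rJ0 // sub0r => /eqP; rewrite oppr_eq0 => /eqP.
- by move=> x; rewrite /r conjB; ring.
Qed.

(** * Best approximation from the unit ball of L^infty *)

Definition unit_ball (phi : T -> C) :=
  cmeasurable phi /\ {ae mu, forall x, Normc.normc (phi x) <= 1}.

Lemma unit_ball_L2 phi : unit_ball phi -> inL2 phi.
Proof. by move=> [m p]; exact: (L2_contractive hmu). Qed.

Lemma unit_ball_nrm2 phi : unit_ball phi -> nrm2 phi <= nrm2 (fun _ => 1).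
Proof.
move=> [m p]; have := (L2M_ae m p (L2_cst mu1 1)).2.
by under [in X in X <= _]eq_fun do rewrite mulr1.
Qed.

Lemma unit_ball_convex phi k (t : R) : 0 <= t <= 1 -> unit_ball phi -> unit_ball k ->
  unit_ball (fun x => phi x + t%:C * (k x - phi x)).
Proof.
move=> /andP[t0 t1] [m1 p1] [m2 p2]; split.
  apply: cmeasurableD => //; apply: cmeasurableM; first exact: cmeasurable_cst.
  exact: cmeasurableB.
apply: filterS2 p1 p2 => x h1 h2.
have -> : phi x + t%:C * (k x - phi x) = (1 - t)%:C * phi x + t%:C * k x.
  by rewrite rmorphB rmorph1; ring.
apply: le_trans (le_normcD _ _) _; rewrite !Normc.normcM !normcR !ger0_norm //; last by lra.
by nra.
Qed.

(** The excess of |phi| over 1 is at most |u_j - phi| almost everywhere for every j, so its L2 norm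
    is 0. *)
Lemma unit_ball_closed (u : nat -> T -> C) phi : (forall j, unit_ball (u j)) ->
  inL2 phi -> nrm2 (fun x => u j x - phi x) @[j --> \oo] --> 0 -> unit_ball phi.
Proof.
move=> hu Lphi cv; split; first exact: L2_meas Lphi.
pose ex x : R := Num.max 0 (Normc.normc (phi x) - 1).
have ex0 x : 0 <= ex x by rewrite le_max lexx.
have mex : measurable_fun setT ex.
  apply: measurable_maxr; first exact: measurable_cst.
  apply: measurable_funB; last exact: measurable_cst.
  by apply: measurable_normc; exact: L2_meas Lphi.
pose f x : C := (ex x)%:C.
have mf : cmeasurable f by exact: cmeasurable_real.
have exle x : ex x <= Normc.normc (phi x).
  by rewrite ge_max normc_ge0 /= gerBl.
have Lf : inL2 f.
  apply: L2_le (L2_rint Lphi) _ => // x; rewrite normcR ger0_norm //.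
  by rewrite lerXn2r ?nnegrE ?normc_ge0.
have le j : nrm2 f <= nrm2 (fun x => u j x - phi x).
  have Lu := unit_ball_L2 (hu j).
  have Ld := L2B Lu Lphi.
  rewrite -lee_fin -!pnorm2E //.
  apply: ae_ge0_le_integral => //; try by move=> x _; rewrite lee_fin sqr_ge0.
  - by apply/measurable_EFinP; exact: measurable_normcX.
  - by apply/measurable_EFinP; apply: measurable_normcX; exact: L2_meas Ld.
  - apply: filterS (hu j).2 => x ux _; rewrite lee_fin lerXn2r ?nnegrE ?normc_ge0 //.
    rewrite normcR ger0_norm // ge_max normc_ge0 /=.
    have := le_normcD (u j x) (phi x - u j x); rewrite (addrC (u j x)) subrK normcB.
    by lra.
have f0 : nrm2 f = 0.
  apply/eqP; rewrite eq_le nrm2_ge0 andbT.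
  by apply: (ler_cvg_to (cvg_cst _) cv); apply: nearW.
apply: filterS (nrm2_eq0 Lf f0) => x [] e0.
have : Normc.normc (phi x) - 1 <= ex x by rewrite le_max lexx orbT.
by rewrite e0; lra.
Qed.

(* The best L2-approximation of the coset [psi + perpQ] by the unit ball of
   L^infty is attained by the nested sets lemma; testing optimality against
   the sign of the residual [w] shows [|w|_1 + |w|_2^2 <= |<psi, w>|]. *)
Lemma contractive_symbol psi : Q psi -> XQ_contractive mu Q psi ->
  exists phi, in_schur mu phi /\ forall q, Q q -> inner phi q = inner psi q.
Proof.
move=> Qpsi contr; have Lpsi := quotient_L2 Qpsi.
have pL g : perpQ g -> inL2 g by move=> h; exact: h.1.1.
(* The distance is minimised jointly over [phi] in the ball and [g] in H2 (-) Q. *)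
pose res phi g x := phi x - psi x - g x.
pose V := [set nrm2 (res p.1 p.2) | p in [set p | unit_ball p.1 /\ perpQ p.2]].
pose d := inf V.
have ub0 : unit_ball (fun _ => 0).
  split; first exact: cmeasurable_cst.
  by apply: nearW => x; rewrite Normc.normc0 ler01.
have hV : has_inf V.
  split.
    by exists (nrm2 (res (fun _ => 0) (fun _ => 0))), ((fun _ => 0), (fun _ => 0)) => //=;
       split=> //; exact: subspace0 perpQ_closed.
  by exists 0 => _ [p _ <-]; exact: nrm2_ge0.
have dle phi g : unit_ball phi -> perpQ g -> d <= nrm2 (res phi g).
  by move=> up pg; apply: ge_inf; [exact: hV.2|exists (phi, g)].
have d0 : 0 <= d by apply: lb_le_inf; [exact: hV.1|move=> _ [p _ <-]; exact: nrm2_ge0].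
have Lres phi g : unit_ball phi -> perpQ g -> inL2 (res phi g).
  by move=> up pg; apply: L2B; [apply: L2B => //; exact: unit_ball_L2|exact: pL].
(* Only [phi] is recorded, with [g] quantified away: the ball provides the uniform norm bound that
   [nested_convex] asks for. *)
pose K j := [set phi | unit_ball phi /\ exists2 g, perpQ g & nrm2 (res phi g) <= d + j.+1%:R^-1].
have [|||||u [phi [Ku Lphi ucv]]] := @nested_convex _ _ _ mu1 K (nrm2 (fun _ => 1)).
- by move=> j f [uf _]; exact: unit_ball_L2.
- by move=> j f [uf _]; exact: unit_ball_nrm2.
- move=> j; have [|_ [[f g] [/= uf pg] <-] h] := @inf_adherent _ _ j.+1%:R^-1 _ hV.
    by rewrite invr_gt0 ltr0Sn.
  by exists f; split=> //; exists g => //; exact: ltW.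
- move=> j f [uf [g pg h]]; split=> //; exists g => //; apply: le_trans h _.
  by rewrite lerD2l lef_pV2 ?posrE ?ltr0Sn // ler_nat.
- move=> j f f' [uf [g pg h]] [uf' [g' pg' h']]; split.
    have := @unit_ball_convex f f' 2^-1 _ uf uf'; rewrite invr_ge0 ler0n invf_le1 // ler1n.
    move=> /(_ isT); congr unit_ball; apply/funext => x.
    by apply: complexP; rewrite !cE /=; field.
  exists (fun x => (2^-1)%:C * (g x + g' x)).
    by apply: (subspaceZ perpQ_closed); exact: (subspaceD perpQ_closed).
  rewrite (_ : res _ _ = (fun x => (2^-1)%:C * (res f g x + res f' g' x))); last first.
    by apply/funext => x; rewrite /res; apply: complexP; rewrite !cE /=; field.
  rewrite nrm2_mid; [|exact: Lres|exact: Lres].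
  have := nrm2_ge0 mu (fun x => res f g x - res f' g' x); move: h h'.
  by move: (j.+1%:R^-1 : R) => a; lra.
have uphi : unit_ball phi by apply: (unit_ball_closed (fun j => (Ku j).1) Lphi ucv).
have Lpp : inL2 (fun x => phi x - psi x) by exact: L2B.
(* For the limit [phi] the optimal [g] is recovered as a projection, which also makes the residual
   orthogonal to H2 (-) Q. *)
have [g [pg gp]] := proj_exists mu1 perpQ_closed Lpp.
have Lg := pL _ pg.
pose w := res phi g; have Lw : inL2 w by exact: Lres.
have wperp h : perpQ h -> inner w h = 0 by exact: gp.
have wmin : nrm2 w <= d.
  have wle g' : perpQ g' -> nrm2 w <= nrm2 (res phi g').
    move=> pg'; have pd := subspaceB perpQ_closed pg pg'.
    rewrite (_ : res phi g' = (fun x => w x + (g x - g' x))); last first.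
      by apply/funext => x; rewrite /w /res; ring.
    rewrite (nrm2D Lw (pL _ pd)) wperp //= mulr0 addr0 lerDl; exact: nrm2_ge0.
  have c1 : nrm (fun x => u j x - phi x) + Num.sqrt (d + j.+1%:R^-1)
      @[j --> \oo] --> 0 + Num.sqrt d.
    apply: cvgD; first exact: (@nrm_cvg0 _ _ _ (fun j x => u j x - phi x)).
    have h : d + j.+1%:R^-1 @[j --> \oo] --> d.
      by rewrite -[X in _ --> X]addr0; apply: cvgD; [exact: cvg_cst|exact: cvg_harmonic].
    by apply: (cvg_comp _ _ h); exact: sqrt_continuous.
  have h : nrm w <= Num.sqrt d.
    rewrite -[leRHS]add0r; apply: (ler_cvg_to (cvg_cst (nrm w)) c1).
    apply: nearW => j; have [uj [g' pg' hg']] := Ku j.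
    have Lu := unit_ball_L2 uj; have Lj := Lres _ _ uj pg'.
    apply: (@le_trans _ _ (nrm (fun x => u j x - phi x) + nrm (res (u j) g'))).
      apply: (@le_trans _ _ (nrm (res phi g'))).
        by rewrite /L2norm ler_sqrt ?nrm2_ge0 // wle.
      rewrite nrmBC (_ : res phi g' = (fun x => (phi x - u j x) + res (u j) g' x)).
        by apply: nrmD => //; exact: L2B.
      by apply/funext => x; rewrite /res; ring.
    by rewrite lerD2l /L2norm ler_sqrt // (le_trans (nrm2_ge0 mu (res (u j) g'))).
  rewrite -sqr_nrm -[leRHS]sqr_sqrtr //.
  by rewrite lerXn2r ?nnegrE ?nrm_ge0 ?sqrtr_ge0.
(* First-order optimality at [phi] along the segment towards [k], which stays in the convex ball. *)
have vari k : unit_ball k -> 0 <= complex.Re (inner w (fun x => k x - phi x)).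
  move=> uk; have Lk := unit_ball_L2 uk; have Lkp := L2B Lk Lphi.
  set a := complex.Re _; set b := nrm2 (fun x => k x - phi x).
  have b0 : 0 <= b := nrm2_ge0 _ _.
  have step t : 0 <= t <= 1 -> 0 <= t ^+ 2 * b + 2 * (t * a).
    move=> t01; have := dle _ _ (unit_ball_convex t01 uphi uk) pg.
    move=> /(le_trans wmin).
    rewrite (_ : res _ _ = (fun x => w x + t%:C * (k x - phi x))); last first.
      by apply/funext => x; rewrite /w /res; ring.
    rewrite (nrm2D Lw (L2Z t%:C Lkp)).
    have reM (z : C) : complex.Re (t%:C * z) = t * complex.Re z.
      by case: z => x y /=; rewrite mul0r subr0.
    rewrite nrm2Z // inner_scaler // conjCR normcR real_normK ?num_real // reM.
    by rewrite -/a -/b -addrA lerDl.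
  rewrite leNgt; apply/negP => a0.
  (* If the derivative [a] were negative, the quadratic t^2 b + 2 t a would be negative at its
     vertex -a / b, or at t = 1 when the vertex lies beyond the segment. *)
  have [ab|ab] := lerP (- a) b; last first.
    by have := step 1; rewrite lexx ler01 => /(_ isT); rewrite expr1n; lra.
  have bp : 0 < b by lra.
  have t01 : 0 <= - a / b <= 1.
    by rewrite divr_ge0 ?ler_pdivrMr ?mul1r //=; lra.
  have := step _ t01.
  rewrite (_ : _ + _ = - (a ^+ 2 / b)); last by field; lra.
  rewrite oppr_ge0 leNgt divr_gt0 //.
  by rewrite exprn_even_gt0 //= lt_eqF.
(* The point of the ball at which Re <w, s> is least, namely -|w|_1. *)
pose s x := - csgn (w x).
have mJ : cmeasurable w := L2_meas Lw.
have us : unit_ball s.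
  split; last by apply: nearW => x; rewrite normcN normc_csgn_le.
  apply: cmeasurableN; rewrite /csgn; apply: cmeasurableM => //.
  have -> : (fun x => ((Normc.normc (w x))%:C)^-1) = (fun x => (Normc.normc (w x) `^ (-1))%:C).
    by apply/funext => x; rewrite -(fmorphV (real_complex R)) powR_inv1 // normc_ge0.
  apply: cmeasurable_real.
  exact: (measurableT_comp (measurable_powR (-1)) (measurable_normc mJ)).
have Ls := unit_ball_L2 us.
pose W := Rintegral mu setT (fun x => Normc.normc (w x)).
have ws : inner w s = - W%:C.
  have <- : inner w (fun x => (-1) * csgn (w x)) = inner w s.
    by congr Defs.inner; apply/funext => x; rewrite mulN1r.
  have Lc : inL2 (fun x => csgn (w x)).
    by have := L2N Ls; rewrite /s; under eq_fun do rewrite opprK.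
  rewrite inner_scaler // rmorphN1 mulN1r; congr (- _).
  rewrite -cint_real; congr cint; apply/funext => x; exact: csgnE.
have Lgp := L2D Lpsi Lg.
have wphi : inner w phi = (nrm2 w)%:C + inner w psi.
  have -> : phi = (fun x => w x + (psi x + g x)) by apply/funext => x; rewrite /w /res; ring.
  by rewrite (inner_addr Lw Lgp Lw) (inner_addr Lpsi Lg Lw) inner_nrm2 (wperp g pg) addr0.
have wpsi : - complex.Re (inner w psi) <= W.
  have MQ : in_MQ mu Q (fun x => (w x)^*) by exact: perp_perpQ_MQ.
  have := contr _ MQ; rewrite norm1E; last exact: L2J.
  rewrite lee_fin; under eq_Rintegral do rewrite normcJ.
  rewrite -/W -/(Defs.inner mu psi w) (inner_conj Lw Lpsi) normcJ.
  have := normr_Re_le (inner w psi); rewrite ler_norml => /andP[h _] h'.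
  by lra.
(* Optimality against [s] gives |w|_1 + |w|_2^2 <= -Re <w, psi>, and contractivity bounds the right
   side by |w|_1. *)
have w0 : nrm2 w = 0.
  have h : 0 <= - W - (nrm2 w + complex.Re (inner w psi)).
    by have := vari _ us; rewrite inner_subr // ws wphi !(cReD, cReN).
  by apply/eqP; rewrite eq_le nrm2_ge0 andbT; move: h wpsi; lra.
have pae : phi =ae (fun x => psi x + g x).
  apply: filterS (nrm2_eq0 Lw w0) => x /eqP; rewrite /w /res subr_eq0 => /eqP <-.
  by rewrite addrC subrK.
have phiE h : inL2 h -> inner phi h = inner psi h + inner g h.
  move=> Lh; rewrite -inner_addl //; apply: inner_ae => //; try exact: L2_meas Lh.
  - exact: L2_meas Lphi.
  - exact: L2_meas Lgp.
  - by apply: nearW.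
exists phi; split.
  (* Analyticity was not imposed on the ball; it comes from phi = psi + g with both terms in H2. *)
  split; [exact: uphi.1|exact: uphi.2|] => k kZ.
  rewrite fourierE phiE; last exact: L2_monomial.
  by rewrite [inner psi _]((quotient_H2 Qpsi).2 k kZ) [inner g _](pg.1.2 k kZ) addr0.
by move=> q Qq; rewrite phiE ?(pg.2 q Qq) ?addr0 //; exact: quotient_L2.
Qed.

(** * Agreement of [X] with the compression of [phi] *)

Hypothesis hM : module_map mu Q X.

Lemma X_nrm f : Q f -> nrm (X f) <= nrm f.
Proof.
move=> Qf; case: hX => _ _ _ /(_ _ Qf).
rewrite !pnorm2E; [|exact: quotient_L2|exact: X_L2].
by rewrite lee_fin => h; rewrite /L2norm ler_sqrt // nrm2_ge0.
Qed.

Lemma inner_XD f g q : Q f -> Q g -> Q q ->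
  inner (X (fun x => f x + g x)) q = inner (X f) q + inner (X g) q.
Proof.
move=> Qf Qg Qq; have Lq := quotient_L2 Qq.
have [Lf Lg] := (X_L2 Qf, X_L2 Qg).
have Lfg := X_L2 (subspaceD quotient_closed Qf Qg).
rewrite -inner_addl //; apply: inner_ae; try exact: L2_meas Lq.
- exact: L2_meas Lfg.
- exact: L2_meas (L2D Lf Lg).
- by case: hX => _ h _ _; exact: h.
- by apply: nearW.
Qed.

Lemma inner_XZ c f q : Q f -> Q q ->
  inner (X (fun x => c * f x)) q = c * inner (X f) q.
Proof.
move=> Qf Qq; have Lq := quotient_L2 Qq; have Lf := X_L2 Qf.
have Lcf := X_L2 (subspaceZ quotient_closed c Qf).
rewrite -inner_scalel //; apply: inner_ae; try exact: L2_meas Lq.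
- exact: L2_meas Lcf.
- exact: L2_meas (L2Z c Lf).
- by case: hX => _ _ h _; exact: h.
- by apply: nearW.
Qed.

Section Lift.
Variable phi : T -> C.
Hypothesis sphi : in_schur mu phi.
Hypothesis lift1 : forall q, Q q -> inner phi q = inner (X PQ1) q.

Lemma L2M_schur f : inL2 f -> inL2 (fun x => phi x * f x).
Proof. by case: sphi => ? ? _ Lf; apply: (L2M_ae _ _ Lf).1. Qed.

(** Induction on k: P_Q(z_i z^k) = P_Q(z_i P_Q z^k) because H2 (-) Q is invariant, and commutation
    gives X P_Q(z_i P_Q z^k) = P_Q(z_i X P_Q z^k). Both are read through a backward shift of [q]. *)
Lemma lift_monomial k : in_Zplus k -> exists P, is_proj mu Q (monomial k) P /\
  forall q, Q q -> inner (fun x => monomial k x * phi x) q = inner (X P) q.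
Proof.
have Lphi := schur_L2 sphi.
move: k; apply: Zplus_ind => [|k i kZ [P [[QP Pk] XP]]].
  exists PQ1; split.
    by rewrite (_ : monomial _ = (fun _ => 1)) //; apply/funext => x; rewrite monomial0.
  by move=> q Qq; under eq_fun do rewrite monomial0 mul1r; exact: lift1.
have eZ : in_Zplus (fun j : 'I_n => (j == i)%:R) by move=> j; case: eqP.
have mE : monomial (fun j => (j == i)%:R + k j) = (fun x => zcoord i x * monomial k x) :> (T -> C).
  by apply/funext => x; rewrite monomialM -zcoordE.
have HzH f : inH2 f -> inH2 (fun x => zcoord i x * f x).
  by move=> Hf; under eq_fun do rewrite zcoordE; exact: H2M_monomial.
have HP := quotient_H2 QP; have HXP := quotient_H2 (X_Q QP).
have [P' pP'] := proj_exists mu1 quotient_closed (HzH _ HP).1.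
have QP' := pP'.1.
have Hk := H2_monomial kZ.
exists P'; split.
  split=> // q Qq; have [q' [Qq' adj]] := backward_shift i Qq.
  have [Lq Lq'] := (quotient_L2 Qq, quotient_L2 Qq').
  rewrite mE inner_subl //; [|exact: (HzH _ Hk).1|exact: quotient_L2].
  rewrite -(is_proj_sub quotient_closed (HzH _ HP).1 pP' Qq) !adj //.
  by rewrite (is_proj_sub quotient_closed Hk.1 (conj QP Pk) Qq') subrr.
move=> q Qq; have [q' [Qq' adj]] := backward_shift i Qq.
have pXP' := hM QP pP'.
rewrite -(is_proj_sub quotient_closed (HzH _ HXP).1 pXP' Qq) adj // -XP // -adj.
  by congr cint; apply/funext => x; rewrite mE !mulrA.
by apply: H2M_monomial => //; exact: schur_H2.
Qed.

(** The matrix coefficient <(S_phi - X) f, q>. As a number it is exactly linear in [f], whereas [X]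
    is linear only almost everywhere. *)
Definition defect q f := inner (fun x => phi x * f x) q - inner (X f) q.

Lemma defectD q f g : Q q -> Q f -> Q g ->
  defect q (fun x => f x + g x) = defect q f + defect q g.
Proof.
move=> Qq Qf Qg; rewrite /defect inner_XD //.
under [in X in X - _]eq_fun do rewrite mulrDr.
rewrite inner_addl; [by ring| | |exact: quotient_L2];
  by apply: L2M_schur; exact: quotient_L2.
Qed.

Lemma defectZ q c f : Q q -> Q f -> defect q (fun x => c * f x) = c * defect q f.
Proof.
move=> Qq Qf; rewrite /defect inner_XZ // mulrBr; congr (_ - _).
rewrite -inner_scalel; [|exact/L2M_schur/quotient_L2|exact: quotient_L2].
by congr Defs.inner; apply/funext => x; rewrite (mulrCA (phi x)).
Qed.

(** The factor 2 counts two contractions, [S_phi] and [X]. *)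
Lemma defect_le q f : Q q -> Q f ->
  Normc.normc (defect q f) <= 2 * nrm f * nrm q.
Proof.
move=> Qq Qf; have [Lq Lf] := (quotient_L2 Qq, quotient_L2 Qf).
apply: le_trans (le_normcD _ _) _; rewrite normcN.
have h1 := inner_le (X_L2 Qf) Lq; have h2 := inner_le (L2M_schur Lf) Lq.
have h3 := X_nrm Qf.
have h4 : nrm (fun x => phi x * f x) <= nrm f.
  case: sphi => m1 m2 _; have [_ h] := L2M_ae m1 m2 Lf.
  by rewrite /L2norm ler_sqrt ?nrm2_ge0.
have := nrm_ge0 mu q; nra.
Qed.

(** A monomial with exponent outside Z_+^n projects to 0 because [Q] lies in H2. For the others, phi
    z^k and phi P_Q z^k differ by phi times an element of H2 (-) Q, which is orthogonal to [Q]. *)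
Lemma defect_trig p : trigpoly p -> exists P, is_proj mu Q p P /\
  forall q, Q q -> defect q P = 0.
Proof.
have cQ := quotient_closed.
elim=> [k|p1 p2 t1 [P1 [h1 d1]] t2 [P2 [h2 d2]]|c p' t [P [h d]]].
- have [kZ|kZ] := pselect (in_Zplus k); last first.
    exists (fun _ => 0); split.
      split; first exact: subspace0 cQ.
      move=> h Qh; under eq_fun do rewrite subr0.
      have Lh := quotient_L2 Qh.
      rewrite (inner_conj Lh (L2_monomial hmu k)) [inner h _]((quotient_H2 Qh).2 k kZ).
      exact: conjC0.
    move=> q Qq; have := defectZ 0 Qq (subspace0 cQ).
    by rewrite !mul0r.
  have [P [pP XP]] := lift_monomial kZ; exists P; split=> // q Qq.
  have Lk := L2_monomial hmu k; have LP := quotient_L2 pP.1.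
  have pp : perpQ (fun x => monomial k x - P x).
    split; last exact: pP.2.
    by apply: (subspaceB H2_closed); [exact: H2_monomial|exact: quotient_H2 pP.1].
  have := schur_perp sphi pp Qq; under eq_fun do rewrite mulrBr.
  rewrite inner_subl; [|exact: L2M_schur|exact: L2M_schur|exact: quotient_L2].
  rewrite /defect -XP //; under [in X in X - _]eq_fun do rewrite mulrC.
  by move/eqP; rewrite subr_eq0 => /eqP ->; rewrite subrr.
- have [L1 L2] := (trig_L2 hmu t1, trig_L2 hmu t2).
  exists (fun x => P1 x + P2 x); split.
    split; first exact: (subspaceD cQ h1.1 h2.1).
    move=> q Qq; have Lq := quotient_L2 Qq.
    rewrite inner_subl //; [|exact: L2D|exact: quotient_L2 (subspaceD cQ h1.1 h2.1)].
    rewrite !inner_addl //; [|exact: quotient_L2 h1.1|exact: quotient_L2 h2.1].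
    rewrite (is_proj_sub cQ L1 h1 Qq) (is_proj_sub cQ L2 h2 Qq).
    by rewrite subrr.
  by move=> q Qq; rewrite defectD ?d1 ?d2 ?addr0 //; [exact: h1.1|exact: h2.1].
- have L := trig_L2 hmu t; exists (fun x => c * P x); split.
    split; first exact: (subspaceZ cQ c h.1).
    move=> q Qq; have Lq := quotient_L2 Qq.
    rewrite inner_subl //; [|exact: L2Z|exact: quotient_L2 (subspaceZ cQ c h.1)].
    rewrite !inner_scalel //; last exact: quotient_L2 h.1.
    by rewrite (is_proj_sub cQ L h Qq) subrr.
  by move=> q Qq; rewrite defectZ ?d ?mulr0 //; exact: h.1.
Qed.

(** If [p] is a polynomial near [f], then f - P_Q p = P_Q(f - p) is no larger than f - p, and
    subtracting P_Q p leaves the defect unchanged. *)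
Lemma defect0 q f : Q q -> Q f -> defect q f = 0.
Proof.
move=> Qq Qf; have [Lq Lf] := (quotient_L2 Qq, quotient_L2 Qf).
apply: normc0_eq0; apply/eqP; rewrite eq_le normc_ge0 andbT.
apply/ler_addgt0Pl => e e0; rewrite addr0.
have q0 := nrm_ge0 mu q.
(* The added 1 keeps the divisor positive when [q] is null. *)
have K0 : 0 < 2 * (nrm q + 1) by lra.
have [p [tp hp]] := trig_dense hmu Lf (divr_gt0 e0 K0).
have Lp := trig_L2 hmu tp.
have [P [pP dP]] := defect_trig tp.
have QfP := subspaceB quotient_closed Qf pP.1.
have LP := quotient_L2 pP.1.
have -> : defect q f = defect q (fun x => f x - P x).
  rewrite -[RHS]addr0 -(dP q Qq) -defectD //; last exact: pP.1.
  by congr defect; apply/funext => x; rewrite subrK.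
apply: le_trans (defect_le Qq QfP) _.
have : nrm (fun x => f x - P x) <= nrm (fun x => f x - p x).
  rewrite /L2norm ler_sqrt ?nrm2_ge0 //; apply: (proj_contract quotient_closed).
    exact: L2B.
  split=> // h Qh; have Lh := quotient_L2 Qh.
  rewrite inner_subl //; [|exact: L2B|exact: L2B].
  by rewrite !inner_subl // (is_proj_sub quotient_closed Lp pP Qh) subrr.
move: hp; rewrite ltr_pdivlMr // => hp h.
have := nrm_ge0 mu (fun x => f x - P x); nra.
Qed.

End Lift.

Lemma contractive_liftable : XQ_contractive mu Q (X PQ1) -> liftable mu Q X.
Proof.
move=> /(contractive_symbol (X_Q hP.1)) [phi [sphi lift1]].
exists phi; split=> // f Qf; split; first exact: X_Q.
move=> q Qq; rewrite inner_subl; [|exact: L2M_schur (quotient_L2 Qf)|exact: X_L2|exact: quotient_L2].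
exact: defect0.
Qed.

End QuotientModule.
End Hardy.

Theorem theorem4p1 (R : realType) (n : nat)
    (mu : {measure set (torus R n) -> \bar R})
    (Q : set (torus R n -> R[i]))
    (X : (torus R n -> R[i]) -> (torus R n -> R[i]))
    (PQ1 : torus R n -> R[i]) :
  (0 < n)%N ->
  is_torus_measure mu ->
  quotient_module mu Q ->
  contraction_on mu Q X ->
  module_map mu Q X ->
  is_proj mu Q (fun _ => 1) PQ1 ->
  (liftable mu Q X <-> XQ_contractive mu Q (X PQ1)).
Proof.
move=> _ hmu hQ hX hM hP; split.
  exact: liftable_contractive.
exact: contractive_liftable.
Qed.
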